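(* Let $A\in\mathbb{R}^{d\times d}$ be symmetric, $b\in\mathbb{R}^d$, $R>0$, $f(x)=\tfrac12x^TAx+b^Tx$, and $x^\star\in\arg\min_{\|x\|\le R}f(x)$. Let $v$ be uniformly distributed on the unit sphere in $\mathbb{R}^d$, let $t\ge2$ be an integer, put $k=\lfloor t/2\rfloor$, and let $\hat s_t$ be a minimizer of $f$ over $\{x\in\mathrm{span}\{b,Ab,\dots,A^{k-1}b,\,v,Av,\dots,A^{k-1}v\}:\ \|x\|\le R\}$. Then for any $\delta>0$, with probability at least $1-\delta$ with respect to the random choice of $v$, $$f(\hat s_t)-f(x^\star)\le\frac{(\lambda_{\max}-\lambda_{\min})R^2}{(t-1)^2}\left[16+2\cdot\mathbb{1}_{\{\lambda_{\min}<0\}}\log^2\left(\frac{2\sqrt d}{\delta}\right)\right].$$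
   Context: $\|\cdot\|$ is the Euclidean norm. $\lambda_{\min}\le\lambda_{\max}$ are the smallest and largest eigenvalues of $A$. $\mathbb{1}_{\{\lambda_{\min}<0\}}$ equals $1$ if $\lambda_{\min}<0$ and $0$ otherwise. *)

(* Defs.v *)
(* MathComp-Analysis *)
From HB Require Import structures.
From mathcomp Require Import all_boot all_order all_algebra.
From mathcomp Require Import all_classical all_reals all_analysis.
Set Implicit Arguments.
Unset Strict Implicit.
Unset Printing Implicit Defensive.
Import Order.TTheory GRing.Theory Num.Theory.
Import numFieldNormedType.Exports.
Local Open Scope classical_set_scope.
Local Open Scope ring_scope.

(* The library's norm `|x| on matrices is the sup norm. *)
Definition enorm (R : realType) (d : nat) (x : 'cV[R]_d) : R :=
  Num.sqrt (\sum_(i < d) x i 0 ^+ 2).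

Definition quad (R : realType) (d : nat) (A : 'M[R]_d) (b x : 'cV[R]_d) : R :=
  2^-1 * (x^T *m A *m x) 0 0 + (b^T *m x) 0 0.

Definition smallest_eigenvalue (R : realType) (d : nat) (A : 'M[R]_d) (l : R) :=
  eigenvalue A l /\ forall a : R, eigenvalue A a -> l <= a.

Definition largest_eigenvalue (R : realType) (d : nat) (A : 'M[R]_d) (l : R) :=
  eigenvalue A l /\ forall a : R, eigenvalue A a -> a <= l.

Definition is_argmin (R : realType) (d : nat) (f : 'cV[R]_d -> R)
    (D : set 'cV[R]_d) (x : 'cV[R]_d) : Prop :=
  D x /\ forall y : 'cV[R]_d, D y -> f x <= f y.

Definition krylov (R : realType) (d : nat) (A : 'M[R]_d) (u : 'cV[R]_d)
    (k : nat) : seq 'cV[R]_d :=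
  mkseq (fun i => A ^+ i *m u) k.

(* R^d with its Borel sigma-algebra; convertible to 'cV[R]_d.  The sup norm and
   the Euclidean norm have the same open sets. *)
Definition borel_cV (R : realType) (d : nat) :=
  g_sigma_algebraType (@open 'cV[R]_d).

(* The uniform distribution on the Euclidean unit sphere: the unique Borel
   probability on R^d carried by the sphere and invariant under the orthogonal
   group O(d).  (With rotations SO(d) only, uniqueness would fail for d = 1.)
   No such law exists for d = 0, where the sphere is empty. *)
Definition uniform_on_sphere (R : realType) (d : nat)
    (mu : set (borel_cV R d) -> \bar R) : Prop :=
  mu [set x : 'cV[R]_d | enorm x = 1] = 1%E /\
  forall Q : 'M[R]_d, Q^T *m Q = 1%:M ->
    forall B : set (borel_cV R d), measurable B ->
      mu [set x : 'cV[R]_d | B (Q *m x)] = mu B.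

(* Main.v *)
(* Write M = A - lmin, so that 0 <= M <= L = lmax - lmin, and let u be a unit
   eigenvector for lmin.

   Accelerated proximal gradient steps for 1/2 x^T M x + b^T x, plus
   lmin/2 |x|^2 when lmin >= 0, stay in the Krylov space of b and in the ball,
   and reach the gap 8 L r^2 / (t - 1)^2.  This settles lmin >= 0.

   If lmin < 0, f is that convex quadratic minus |lmin|/2 |x|^2.  From the
   accelerated point x, move along a unit vector z of the Krylov space of v to
   the sphere, in the direction in which the convex part decreases to first
   order: the step is at most 2r, so it costs at most 2 r^2 z^T M z.  Taking
   for z a shifted odd Chebyshev polynomial of M applied to v gives
   z^T M z <= L tanh^2(ln(2 / |u.v|) / (2k - 1)); the bound
   tanh^2 x <= x^2 / (1 + x^2 / 4) absorbs the loss when t is odd.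

   Finally P(|u.v| < e) <= e sqrt d: invariance under rotations gives
   E[(1 - x^2) h'(x)] = (d - 1) E[x h(x)] for x = u.v, applied to the clipped
   linear function h(x) = max(-1, min(1, x / e)), together with
   E|x| <= 1 / sqrt d. *)
Require Import Defs.
From HB Require Import structures.
From mathcomp Require Import all_boot all_order all_algebra.
From mathcomp Require Import all_classical all_reals all_analysis.
From mathcomp Require Import measurable_realfun complex.
From mathcomp Require Import ring lra zify.
Set Implicit Arguments.
Unset Strict Implicit.
Unset Printing Implicit Defensive.
Import Order.TTheory GRing.Theory Num.Theory.
Import numFieldNormedType.Exports.
Local Open Scope classical_set_scope.
Local Open Scope ring_scope.

(** * Inner products, quadratics and Krylov spaces *)

Definition dot (R : realType) (n : nat) (x y : 'cV[R]_n) : R := (x^T *m y) 0 0.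

Lemma dotE (R : realType) n (x y : 'cV[R]_n) : dot x y = \sum_i x i 0 * y i 0.
Proof. by rewrite /dot mxE; apply: eq_bigr => i _; rewrite mxE. Qed.

Lemma dotC (R : realType) n (x y : 'cV[R]_n) : dot x y = dot y x.
Proof. by rewrite !dotE; apply: eq_bigr => i _; rewrite mulrC. Qed.

Lemma dotDl (R : realType) n (x y z : 'cV[R]_n) : dot (x + y) z = dot x z + dot y z.
Proof. by rewrite /dot linearD mulmxDl mxE. Qed.

Lemma dotDr (R : realType) n (x y z : 'cV[R]_n) : dot z (x + y) = dot z x + dot z y.
Proof. by rewrite dotC dotDl !(dotC _ z). Qed.

Lemma dotZl (R : realType) n a (x z : 'cV[R]_n) : dot (a *: x) z = a * dot x z.
Proof. by rewrite /dot linearZ -scalemxAl mxE. Qed.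

Lemma dotZr (R : realType) n a (x z : 'cV[R]_n) : dot z (a *: x) = a * dot z x.
Proof. by rewrite dotC dotZl dotC. Qed.

Lemma dotNl (R : realType) n (x z : 'cV[R]_n) : dot (- x) z = - dot x z.
Proof. by rewrite -scaleN1r dotZl mulN1r. Qed.

Lemma dotNr (R : realType) n (x z : 'cV[R]_n) : dot z (- x) = - dot z x.
Proof. by rewrite dotC dotNl dotC. Qed.

Lemma dot0l (R : realType) n (x : 'cV[R]_n) : dot 0 x = 0.
Proof. by rewrite -(scale0r x) dotZl mul0r. Qed.

Lemma dot_mxl (R : realType) n (A : 'M[R]_n) (x y : 'cV[R]_n) :
  dot (A *m x) y = dot x (A^T *m y).
Proof. by rewrite /dot trmx_mul mulmxA. Qed.

Definition dotL := (dotDl, dotDr, dotZl, dotZr, dotNl, dotNr).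

Lemma dot_ge0 (R : realType) n (x : 'cV[R]_n) : 0 <= dot x x.
Proof. by rewrite dotE sumr_ge0 // => i _; rewrite -expr2 sqr_ge0. Qed.

Lemma dot_eq0 (R : realType) n (x : 'cV[R]_n) : (dot x x == 0) = (x == 0).
Proof.
apply/eqP/eqP => [|->]; last by rewrite dot0l.
rewrite dotE => /psumr_eq0P x0; apply/colP => i; rewrite mxE.
by apply/eqP; rewrite -sqrf_eq0 expr2 x0 // => j _; rewrite -expr2 sqr_ge0.
Qed.

Lemma enormE (R : realType) n (x : 'cV[R]_n) : enorm x = Num.sqrt (dot x x).
Proof. by rewrite /enorm dotE; congr Num.sqrt; apply: eq_bigr => i _; rewrite expr2. Qed.

Lemma enorm_le (R : realType) n (x : 'cV[R]_n) r : 0 <= r ->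
  (enorm x <= r) = (dot x x <= r ^+ 2).
Proof.
by move=> r0; rewrite enormE -(ler_sqr (sqrtr_ge0 _) r0) sqr_sqrtr ?dot_ge0.
Qed.

Lemma enorm_eq1 (R : realType) n (x : 'cV[R]_n) : enorm x = 1 <-> dot x x = 1.
Proof.
rewrite enormE; split=> [h|->]; last exact: sqrtr1.
by rewrite -(sqr_sqrtr (dot_ge0 x)) h expr1n.
Qed.

Lemma quadE (R : realType) n (A : 'M[R]_n) b x :
  quad A b x = 2^-1 * dot x (A *m x) + dot b x.
Proof. by rewrite /quad /dot mulmxA. Qed.

Lemma Cauchy_Schwarz (R : realType) n (x y : 'cV[R]_n) :
  dot x y ^+ 2 <= dot x x * dot y y.
Proof.
have [->|y0] := eqVneq y 0.
  by rewrite dotC !dot0l mulr0 expr0n.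
have yy : 0 < dot y y by rewrite lt_def dot_eq0 y0 dot_ge0.
have := dot_ge0 (dot y y *: x - dot x y *: y).
rewrite !dotL (dotC y x) => h.
rewrite -subr_ge0 -(pmulr_rge0 _ yy); move: h; congr (0 <= _); ring.
Qed.

(** Membership becomes a degree condition on polynomials in [A], the form in which the iterates
    below are tracked. The dimension is [n.+1] because [horner_mx] takes values in a nontrivial
    matrix ring. *)
Lemma krylov_spanP (R : realType) n (A : 'M[R]_n.+1) (u x : 'cV[R]_n.+1) k :
  reflect (exists2 p : {poly R}, (size p <= k)%N & x = horner_mx A p *m u)
          (x \in <<krylov A u k>>%VS).
Proof.
apply: (iffP idP) => [xK|[p pk ->]].
  have sK : size (krylov A u k) == k by rewrite size_mkseq.
  have /= xE := @coord_span _ _ k (Tuple sK) x xK.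
  (* The coefficients are the coordinates of [x] along the Krylov vectors. [insub] only turns
     [i < k] into an ordinal; its default 0 is never reached. *)
  exists (\poly_(i < k) (if insub i is Some j then coord (Tuple sK) j x else 0)).
    exact: size_poly.
  rewrite {1}xE poly_def rmorph_sum mulmx_suml; apply: eq_bigr => i _.
  rewrite valK /= linearZ rmorphXn /= horner_mx_X -scalemxAl; congr (_ *: _).
  by rewrite nth_mkseq.
rewrite -[p]coefK poly_def rmorph_sum mulmx_suml memv_suml // => i _.
rewrite /= linearZ rmorphXn /= horner_mx_X -scalemxAl memvZ // memv_span //.
by apply/mapP; exists (val i) => //; rewrite mem_iota /= add0n (leq_trans (ltn_ord i)).
Qed.

(** * Spectral decomposition *)

(** A unitary diagonalisation over the complex numbers has real eigenvalues [l i]; the weights are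
    the squared moduli of the coordinates of [w] in that basis. They form the spectral measure of
    [w], while [l] is chosen before [w]. *)
Lemma spectral_measure (R : rcfType) (n : nat) (A : 'M[R]_n.+1) : A^T = A ->
  exists2 l : 'I_n.+1 -> R, forall i, eigenvalue A (l i) &
  forall w : 'cV[R]_n.+1, exists2 c : 'I_n.+1 -> R, forall i, 0 <= c i &
  forall p : {poly R},
    (w^T *m horner_mx A p *m w) 0 0 = \sum_i p.[l i] * c i.
Proof.
move=> symA; pose f := real_complex R; pose AC := map_mx f A.
have hermA : AC \is hermsymmx.
  apply: realsym_hermsym.
    by apply/is_hermitianmxP; rewrite expr0 scale1r map_mx_id // /AC map_trmx symA.
  by apply/mxOverP => i j; rewrite mxE; apply/complex_realP; exists (A i j).
have [P [D [Pu AE Dr]]] : exists P D, [/\ P \is unitarymx,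
    AC = invmx P *m diag_mx D *m P & D \is a realmx].
  exists (spectralmx AC), (spectral_diag AC); split.
  - exact: spectral_unitarymx.
  - exact/orthomx_spectralP/hermitian_normalmx.
  - exact: hermitian_spectral_diag_real.
have Pi : P \in unitmx by exact: unitarymx_unit.
pose l i := complex.Re (D 0 i).
have DE i : D 0 i = f (l i).
  by rewrite /f /l RRe_real //; apply: (mxOverP Dr).
exists l => [i|w].
  (* The rows of [P] are nonzero left eigenvectors. The eigenvalue descends to the reals as a root
     of the characteristic polynomial. *)
  rewrite eigenvalue_root_char -(fmorph_root f) map_char_poly -/AC.
  rewrite -eigenvalue_root_char; apply/eigenvalueP; exists (row i P).
    transitivity (D 0 i *: row i P); last by rewrite DE.
    by rewrite -row_mul {1}AE !mulmxA mulmxV // mul1mx row_mul row_diag_mx -scalemxAl -rowE.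
  apply: contraTneq Pi => Pi0; apply/negP => /(mulmxV).
  move=> /(congr1 (row i)); rewrite row_mul Pi0 mul0mx => /esym/eqP.
  by rewrite row1 -mxrank_eq0 mxrank_delta.
pose wC := map_mx f w; pose y := P *m wC.
exists (fun i => complex.Re (y i 0 * (y i 0)^*)) => [i|p].
  have : 0 <= y i 0 * (y i 0)^* by exact: mul_conjC_ge0.
  by rewrite lecE => /andP[].
have : f ((w^T *m horner_mx A p *m w) 0 0) =
       \sum_i f p.[l i] * (y i 0 * (y i 0)^*).
  have -> : f ((w^T *m horner_mx A p *m w) 0 0) =
            (wC^T *m horner_mx AC (map_poly f p) *m wC) 0 0.
    by rewrite -map_horner_mx map_trmx -!map_mxM [RHS]mxE.
  have -> : horner_mx AC (map_poly f p) =
       invmx P *m horner_mx (diag_mx D) (map_poly f p) *m P.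
    by rewrite {1}AE horner_mx_uconjC.
  rewrite horner_mx_diag.
  (* Since [w] is real and [P] unitary, [wC^T *m invmx P] is the conjugate transpose of [y]. *)
  have -> : wC^T *m (invmx P *m diag_mx (map_mx (horner (map_poly f p)) D) *m P) *m wC
     = (map_mx Num.conj y)^T *m (diag_mx (map_mx (horner (map_poly f p)) D) *m y).
    have -> : (map_mx Num.conj y)^T = wC^T *m invmx P.
      rewrite invmx_unitary // /y (map_mxM Num.conj) trmx_mul map_trmx.
      rewrite [(map_mx _ P)^T]map_trmx; congr (_ *m _).
      apply/matrixP=> i j; rewrite !mxE; apply/CrealP/complex_realP.
      by exists (w j i).
    by rewrite /y !mulmxA.
  rewrite mxE; apply: eq_bigr => i _.
  rewrite mul_diag_mx !mxE DE horner_map /=; ring.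
move=> /(congr1 (@complex.Re R)) /=; rewrite raddf_sum => ->.
apply: eq_bigr => i _; case: (y i 0 * _) => u v; rewrite /f /=; ring.
Qed.

(** * Accelerated proximal gradient *)

(* [a *: q] minimises [m / 2 * dot z z + dot q z] over the ball. *)
Lemma ball_prox (R : realType) n (q : 'cV[R]_n) (m r : R) : 0 <= m -> 0 < r ->
  exists2 a : R, dot (a *: q) (a *: q) <= r ^+ 2 &
    forall u, dot u u <= r ^+ 2 ->
      0 <= dot (m *: (a *: q) + q) (u - a *: q).
Proof.
(* If the unconstrained minimiser [- q / m] lies in the ball, it is taken. For [m = 0] this case
   forces [q = 0], and the convention [0^-1 = 0] gives the point 0. *)
move=> m0 r0; have [qm|qm] := leP (dot q q) ((m * r) ^+ 2).
  exists (- m^-1).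
    rewrite dotZl dotZr; have [->|mn] := eqVneq m 0.
      by rewrite invr0 oppr0 !mul0r sqr_ge0.
    rewrite -(ler_pM2l (_ : 0 < m ^+ 2)) ?exprn_gt0 ?lt_def ?mn //.
    have -> : m ^+ 2 * (- m^-1 * (- m^-1 * dot q q)) = dot q q by field.
    by rewrite -exprMn.
  move=> u _; suff -> : m *: (- m^-1 *: q) + q = 0 by rewrite dot0l.
  have [m0'|mn] := eqVneq m 0.
    move: qm; rewrite m0' mul0r expr0n /= => qm.
    have /eqP : dot q q == 0 by rewrite eq_le qm dot_ge0.
    by move/eqP; rewrite dot_eq0 => /eqP ->; rewrite !scaler0 addr0.
  by rewrite scalerA mulrN mulfV // scaleN1r addNr.
(* Otherwise the minimiser is the boundary point opposite to [q]. The pairing with [u] factors as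
   [(1 - m r / s) (q.u + s r)], whose second factor is nonnegative by Cauchy-Schwarz. *)
set s := Num.sqrt (dot q q).
have s2 : s ^+ 2 = dot q q by rewrite sqr_sqrtr ?dot_ge0.
have s0 : 0 < s.
  by rewrite sqrtr_gt0; apply: le_lt_trans qm; rewrite sqr_ge0.
have smr : m * r < s by rewrite -ltr_sqr ?nnegrE ?s2 // ?mulr_ge0 // ltW.
exists (- (r / s)).
  by rewrite dotZl dotZr -s2 le_eqVlt; apply/orP; left; apply/eqP; field; rewrite gt_eqF.
move=> u ur.
have cs : dot q u ^+ 2 <= (s * r) ^+ 2.
  by apply: le_trans (Cauchy_Schwarz _ _) _; rewrite exprMn s2 ler_wpM2l ?dot_ge0.
have {}cs : - (s * r) <= dot q u.
  have : `|dot q u| <= s * r by rewrite -ler_sqr ?nnegrE ?normr_ge0 ?real_normK ?num_real // mulr_ge0 // ltW.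
  by rewrite ler_norml => /andP[].
have -> : dot (m *: (- (r / s) *: q) + q) (u - - (r / s) *: q) =
   (1 - m * r / s) * (dot q u + s * r).
  by rewrite !dotL -s2; field; rewrite gt_eqF.
apply: mulr_ge0; last by lra.
by rewrite subr_ge0 ler_pdivrMr // mul1r ltW.
Qed.

(** Taylor's formula is exact for a quadratic; [M *m y + b] is the gradient at [y]. *)
Lemma quad_expand (R : realType) n (M : 'M[R]_n) (b : 'cV[R]_n) : M^T = M -> forall w y,
  quad M b w = quad M b y + dot (M *m y + b) (w - y) + 2^-1 * dot (w - y) (M *m (w - y)).
Proof.
move=> sM w y; rewrite !quadE mulmxDr mulmxN !dotL !dot_mxl sM.
rewrite (_ : dot w (M *m y) = dot y (M *m w)); last by rewrite dotC dot_mxl sM.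
by field.
Qed.

(** The defect is exactly [th (1 - th) |x - z|^2]. *)
Lemma dot_convex (R : realType) n (x z : 'cV[R]_n) th : 0 < th -> th <= 1 ->
  dot ((1 - th) *: x + th *: z) ((1 - th) *: x + th *: z) <=
  (1 - th) * dot x x + th * dot z z.
Proof.
move=> th0 th1; have := mulr_ge0 (mulr_ge0 (ltW th0) (_ : 0 <= 1 - th)) (dot_ge0 (x - z)).
rewrite subr_ge0 => /(_ th1); rewrite !dotL (dotC z x).
move: (dot x x) (dot x z) (dot z z) => a1 a2 a3; rewrite -subr_ge0 => h.
by rewrite -subr_ge0; apply: le_trans h _; rewrite le_eqVlt; apply/orP; left; apply/eqP; ring.
Qed.

(* A proximal step of the method of similar triangles. *)
Lemma accel_step (R : realType) n (M : 'M[R]_n) (b : 'cV[R]_n) (mu L r th c : R)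
    (x z : 'cV[R]_n) :
  M^T = M -> (forall w, 0 <= dot w (M *m w) <= L * dot w w) ->
  0 <= mu -> 0 < r -> 0 < th <= 1 -> 0 <= c -> th * L <= c ->
  dot x x <= r ^+ 2 -> dot z z <= r ^+ 2 ->
  let F w := quad M b w + mu / 2 * dot w w in
  let g := M *m ((1 - th) *: x + th *: z) + b in
  exists z' x' : 'cV[R]_n, [/\ exists a, z' = a *: (g - c *: z),
    dot z' z' <= r ^+ 2,
    x' = (1 - th) *: x + th *: z' &
    forall u, dot u u <= r ^+ 2 ->
     F x' <= (1 - th) * F x + th * F u +
             th * c / 2 * (dot (u - z) (u - z) - dot (u - z') (u - z'))].
Proof.
move=> sM ML mu0 r0 /andP[th0 th1] c0 thL xr zr F g.
have m0 : 0 <= mu + c by rewrite addr_ge0.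
have [a ar prox] := ball_prox (g - c *: z) m0 r0.
set z' := a *: _ in ar prox.
exists z', ((1 - th) *: x + th *: z'); split => //; first by exists a.
move=> u ur; have {}prox := prox u ur.
set y := (1 - th) *: x + th *: z in g z' ar prox *.
clearbody z'.
have /andP[_ h1] := ML (z' - z).
have /andP[h2 _] := ML (x - y).
have /andP[h3 _] := ML (u - y).
have e1 := quad_expand b sM x y.
have e2 := quad_expand b sM u y.
have e3 := quad_expand b sM ((1 - th) *: x + th *: z') y.
rewrite -/g in e1 e2 e3.
(* As [x' - y = th (z' - z)], the curvature term scales with [th^2], and [th L <= c] lets the
   proximal term absorb it in [h7]. *)
have d1 : (1 - th) *: x + th *: z' - y = th *: (z' - z).
  by rewrite /y opprD addrACA subrr add0r scalerBr.
have d2 : dot g (th *: (z' - z)) = (1 - th) * dot g (x - y) + th * dot g (z' - y).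
  rewrite -d1 !dotL; ring.
have d3 : dot (th *: (z' - z)) (M *m (th *: (z' - z))) = th ^+ 2 * dot (z' - z) (M *m (z' - z)).
  by rewrite -scalemxAr dotZl dotZr mulrA.
rewrite d1 d3 d2 in e3.
clearbody g y.
have h4 := dot_convex x z' th0 th1.
(* Three-point inequality: optimality of [z'] for an objective of convexity modulus [mu + c], the
   share of [mu] being dropped through [h6]. *)
have h5 : dot g z' + mu / 2 * dot z' z' + c / 2 * dot (z' - z) (z' - z) <=
   dot g u + mu / 2 * dot u u + c / 2 * (dot (u - z) (u - z) - dot (u - z') (u - z')).
  have h6 : 0 <= mu / 2 * dot (u - z') (u - z') by rewrite mulr_ge0 ?dot_ge0 // divr_ge0.
  move: prox h6; rewrite !dotL (dotC u z') (dotC z z') (dotC z u).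
  move: (dot z' z') (dot z' u) (dot u u) (dot g u) (dot g z') (dot z z') (dot u z) (dot z z) => a1 a2 a3 a4 a5 a6 a7 a8.
  by clear; lra.
rewrite /F e3 e1 e2.
have {}h4 : mu / 2 * dot ((1 - th) *: x + th *: z') ((1 - th) *: x + th *: z') <=
            mu / 2 * ((1 - th) * dot x x + th * dot z' z').
  by apply: ler_wpM2l => //; rewrite divr_ge0.
have {}h5 := ler_wpM2l (ltW th0) h5.
have h7 : th ^+ 2 * dot (z' - z) (M *m (z' - z)) <= th * c * dot (z' - z) (z' - z).
  apply: le_trans (ler_wpM2l (sqr_ge0 _) h1) _; rewrite expr2 mulrA -[X in X * _]mulrA -mulrA.
  by rewrite -!mulrA ler_wpM2l ?(ltW th0) // mulrA ler_wpM2r ?dot_ge0.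
have {}h2 : 0 <= (1 - th) * dot (x - y) (M *m (x - y)) by rewrite mulr_ge0 // subr_ge0.
have {}h3 : 0 <= th * dot (u - y) (M *m (u - y)) by rewrite mulr_ge0 // ltW.
move: h2 h3 h4 h5 h7.
rewrite !(dotDr _ (- y)).
move: (quad M b y) (dot g (- y)) (dot g x) (dot g z') (dot g u) (dot x x) (dot z' z') (dot u u)
  (dot (z' - z) (M *m (z' - z))) (dot (u - y) (M *m (u - y))) (dot (x - y) (M *m (x - y)))
  (dot _ _) (dot (z' - z) (z' - z)) (dot (u - z) (u - z)) (dot (u - z') (u - z')).
clear=> a1 a2 a3 a4 a5 a6 a7 a8 a9 b1 b2 b3 b4 b5 b6.
by lra.
Qed.

(** Nesterov's potential argument: from [x = z = 0] on, the left-hand side does not increase from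
    one step to the next. Each step multiplies by [M] once, which bounds the degrees. *)
Lemma accel (R : realType) n (M : 'M[R]_n.+1) (b : 'cV[R]_n.+1) (mu L r : R) :
  M^T = M -> (forall w, 0 <= dot w (M *m w) <= L * dot w w) ->
  0 <= mu -> 0 <= L -> 0 < r ->
  let F w := quad M b w + mu / 2 * dot w w in
  forall k : nat, exists p q : {poly R},
  let x := horner_mx M p *m b in let z := horner_mx M q *m b in
  [/\ (size p <= k)%N, (size q <= k)%N, dot x x <= r ^+ 2, dot z z <= r ^+ 2 &
    forall u, dot u u <= r ^+ 2 ->
      k%:R * (k%:R + 1) / 4 * (F x - F u) + L / 2 * dot (u - z) (u - z) <= L / 2 * dot u u].
Proof.
move=> sM ML mu0 L0 r0 F; elim=> [|k [p [q /= [sp sq xr zr IH]]]].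
  exists 0, 0; rewrite /= size_poly0 rmorph0 mul0mx dot0l sqr_ge0; split=> // u _.
  by rewrite !mul0r add0r subr0.
set x := horner_mx M p *m b in xr IH; set z := horner_mx M q *m b in zr IH.
have k0 : (0 : R) <= k%:R by exact: ler0n.
have k1 : (0 : R) < k%:R + 1 by lra.
have k2 : (0 : R) < k%:R + 2 by lra.
(* With weight [(k+1)(k+2)/4] these choices turn [1 - th] into the previous weight [k(k+1)/4] and
   [th c / 2] into the constant [L / 2], so the inequalities telescope. *)
pose th : R := 2 / (k%:R + 2); pose c : R := 2 * L / (k%:R + 1).
have th01 : 0 < th <= 1.
  apply/andP; split; first by rewrite /th divr_gt0.
  by rewrite /th ler_pdivrMr // mul1r; lra.
have c0 : 0 <= c by rewrite /c divr_ge0 ?mulr_ge0 // ltW.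
have thL : th * L <= c.
  rewrite /th /c mulrAC ler_wpM2l ?mulr_ge0 // lef_pV2 ?posrE //; lra.
have [z' [x' [[a z'E] z'r x'E step]]] := accel_step b sM ML mu0 r0 th01 c0 thL xr zr.
have pz : exists2 q' : {poly R}, (size q' <= k.+1)%N & z' = horner_mx M q' *m b.
  (* Here [z' = a (M y + b - c z)] with [y = (1 - th) x + th z]; the summand 1 stands for [b]. *)
  exists (a *: ('X * ((1 - th) *: p + th *: q) + 1 - c *: q)).
    apply: leq_trans (size_scale_leq _ _) _.
    apply: leq_trans (size_polyD _ _) _; rewrite geq_max size_polyN.
    rewrite (leq_trans (size_scale_leq _ _)) ?(leqW sq) // andbT.
    apply: leq_trans (size_polyD _ _) _; rewrite geq_max size_poly1 andbT.
    rewrite mulrC; apply: leq_trans (size_polyMleq _ _) _; rewrite size_polyX addn2 /= ltnS.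
    apply: leq_trans (size_polyD _ _) _; rewrite geq_max.
    by rewrite !(leq_trans (size_scale_leq _ _)).
  rewrite z'E /x /z horner_mxZ rmorphB !rmorphD rmorphM rmorphD /= !horner_mxZ horner_mx_X rmorph1.
  rewrite -scalemxAl mulmxBl mulmxDl mul1mx -[c *: _ *m _]scalemxAl.
  by rewrite -[(M * _) *m _]mulmxA mulmxDl -!scalemxAl.
have [q' sq' z'q] := pz.
exists ((1 - th) *: p + th *: q'), q'.
have x'p : horner_mx M ((1 - th) *: p + th *: q') *m b = x'.
  by rewrite rmorphD /= !horner_mxZ mulmxDl -!scalemxAl -z'q x'E.
rewrite /= x'p -z'q; split => //.
- apply: leq_trans (size_polyD _ _) _; rewrite geq_max.
  by rewrite !(leq_trans (size_scale_leq _ _)) // leqW.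
- case/andP: th01 => th0 th1; rewrite x'E; apply: le_trans (dot_convex _ _ th0 th1) _.
  have := ler_wpM2l (ltW th0) z'r; have := ler_wpM2l (_ : 0 <= 1 - th) xr.
  rewrite subr_ge0 => /(_ th1); lra.
move=> u ur; have := IH u ur.
have A0 : 0 <= (k%:R + 1) * (k%:R + 2) / 4 :> R by rewrite divr_ge0 ?mulr_ge0 // ltW.
have := ler_wpM2l A0 (step u ur).
rewrite -/(F _) -/(F u) -/(F x).
have -> : (k%:R + 1) * (k%:R + 2) / 4 * ((1 - th) * F x + th * F u
     + th * c / 2 * (dot (u - z) (u - z) - dot (u - z') (u - z'))) =
   k%:R * (k%:R + 1) / 4 * F x + (k%:R + 1) / 2 * F u +
   L / 2 * (dot (u - z) (u - z) - dot (u - z') (u - z')).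
  by rewrite /th /c; field; rewrite !gt_eqF.
rewrite -[k.+1]addn1 natrD.
move: (F x) (F x') (F u) (dot (u - z) (u - z)) (dot (u - z') (u - z')) (dot u u) => a1 a2 a3 a4 a5 a6.
move: (k%:R : R) => kk; clear; lra.
Qed.

(** * Chebyshev approximation of the bottom eigenvector *)

Lemma horner_mx_sym (R : comNzRingType) n (A : 'M[R]_n.+1) (p : {poly R}) :
  A^T = A -> (horner_mx A p)^T = horner_mx A p.
Proof.
move=> sA; elim/poly_ind: p => [|p c IH]; first by rewrite rmorph0 trmx0.
rewrite rmorphD rmorphM /= horner_mx_X horner_mx_C linearD /= tr_scalar_mx.
rewrite trmx_mul sA IH; congr (_ + _).
by have := comm_horner_mx2 A 'X p; rewrite horner_mx_X.
Qed.

Lemma horner_mx_eigen (R : comNzRingType) n (A : 'M[R]_n.+1) (u : 'cV[R]_n.+1) l p :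
  A *m u = l *: u -> horner_mx A p *m u = p.[l] *: u.
Proof.
move=> Au; elim/poly_ind: p => [|p c IH]; first by rewrite rmorph0 mul0mx horner0 scale0r.
rewrite rmorphD rmorphM /= horner_mx_X horner_mx_C mulmxDl -mulmxA Au -scalemxAr IH.
by rewrite mul_scalar_mx scalerA hornerMXaddC scalerDl mulrC.
Qed.

Lemma horner_mx_comp (R : comNzRingType) n (A : 'M[R]_n.+1) (p q : {poly R}) :
  horner_mx A (p \Po q) = horner_mx (horner_mx A q) p.
Proof.
elim/poly_ind: p => [|p c IH]; first by rewrite comp_poly0 !rmorph0.
by rewrite comp_poly_MXaddC !rmorphD !rmorphM /= IH !horner_mx_C horner_mx_X.
Qed.

Lemma horner_mxM_mul (R : comNzRingType) n (A : 'M[R]_n.+1) (p q : {poly R}) (v : 'cV[R]_n.+1) :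
  horner_mx A (p * q) *m v = horner_mx A p *m (horner_mx A q *m v).
Proof. by rewrite rmorphM /= -mulmxA. Qed.

(* The odd Chebyshev polynomials: [T_(2k-1)(s) = s * (cheb k).[s^2]]. *)
Fixpoint cheb (R : nzRingType) (k : nat) : {poly R} :=
  match k with
  | 0 => 1
  | k1.+1 => match k1 with
             | 0 => 1
             | k2.+1 => (4%:P * 'X - 2%:P) * cheb R k1 - cheb R k2
             end
  end.

Lemma chebSS (R : nzRingType) k :
  cheb R k.+2 = (4%:P * 'X - 2%:P) * cheb R k.+1 - cheb R k.
Proof. by []. Qed.

Lemma size_cheb (R : nzRingType) k : (size (cheb R k.+1) <= k.+1)%N.
Proof.
suff: (size (cheb R k) <= k.+1)%N /\ (size (cheb R k.+1) <= k.+1)%N by case.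
elim: k => [|k [IH1 IH2]]; first by rewrite /= size_poly1.
split; first exact: leqW.
rewrite chebSS; apply: leq_trans (size_polyD _ _) _.
rewrite geq_max [size (- cheb R k)]size_polyN (leq_trans IH1 (leqnSn _)) andbT.
apply: leq_trans (size_polyMleq _ _) _.
have h : (size (4%:P * 'X - 2%:P : {poly R})%R <= 2)%N.
  rewrite -polyCN; apply: leq_trans (size_polyD _ _) _; rewrite geq_max.
  rewrite (leq_trans (size_polyC_leq1 _)) // andbT mul_polyC.
  by rewrite (leq_trans (size_scale_leq _ _)) ?size_polyX.
by have := leq_add h IH2; lia.
Qed.

(** The three-term recurrence preserves this quadratic form in consecutive terms; its value is read
    off at [k = 0], where both terms are 1. It plays the role of [cos^2 + sin^2 = 1]. *)
Lemma cheb_invariant (R : realFieldType) (x : R) k :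
  let a := (cheb R k).[x] in let b := (cheb R k.+1).[x] in
  b ^+ 2 - (4 * x - 2) * a * b + a ^+ 2 = 4 - 4 * x.
Proof.
elim: k => [|k IH] /=; first by rewrite hornerC; ring.
rewrite -/(cheb R k.+1) -/(cheb R k.+2) chebSS; rewrite /= in IH.
rewrite !(hornerD, hornerN, hornerM, hornerC, hornerX) -IH; ring.
Qed.

(** With [x = s^2] this is [|T_(2k-1)(s)| <= 1] on [[-1, 1]]. Completing the square in the invariant
    gives [4 (1 - x) (1 - x a^2) >= 0], which settles all but [x = 1]. *)
Lemma cheb_bound (R : realFieldType) (x : R) k : 0 <= x <= 1 ->
  x * (cheb R k).[x] ^+ 2 <= 1.
Proof.
move=> /andP[x0]; rewrite le_eqVlt => /predU1P[->|x1].
  suff [-> _] : (cheb R k).[1] = 1 /\ (cheb R k.+1).[1] = 1 by rewrite expr1n mulr1.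
  elim: k => [|k [IH1 IH2]]; first by rewrite /= hornerC.
  split=> //; rewrite chebSS !(hornerD, hornerN, hornerM, hornerC, hornerX) IH1 IH2; ring.
have := cheb_invariant x k; rewrite /=.
move: (cheb R k).[x] (cheb R k.+1).[x] => a b inv.
have h : 4 * (1 - x) * (x * a ^+ 2) <= 4 * (1 - x) * 1.
  have := sqr_ge0 (b - (2 * x - 1) * a).
  have -> : (b - (2 * x - 1) * a) ^+ 2 =
     (b ^+ 2 - (4 * x - 2) * a * b + a ^+ 2) - 4 * (1 - x) * (x * a ^+ 2) by ring.
  by rewrite inv; lra.
by rewrite -(ler_pM2l (_ : 0 < 4 * (1 - x))) // mulr_gt0 // subr_gt0.
Qed.

(** For [E = e^theta] one has [y = sinh theta], and the identity reads [T_(2k+1)(i sinh theta) = i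
    (-1)^k sinh((2k+1) theta)]: exponential growth in [k] at the negative argument [- y^2]. *)
Lemma cheb_growth (R : realFieldType) (E : R) k : E != 0 ->
  let y := (E - E^-1) / 2 in
  y * (cheb R k.+1).[- y ^+ 2] = (-1) ^+ k * (E ^+ (2 * k).+1 - E ^- (2 * k).+1) / 2.
Proof.
move=> E0 y.
pose T k : R := (-1) ^+ k * (E ^+ (2 * k).+1 - E ^- (2 * k).+1) / 2.
suff: y * (cheb R k.+1).[- y ^+ 2] = T k /\ y * (cheb R k.+2).[- y ^+ 2] = T k.+1 by case.
elim: k => [|k [IH1 IH2]].
  rewrite /T /= !(hornerD, hornerN, hornerM, hornerC, hornerX) /y; split; field; exact: E0.
split=> //; rewrite chebSS.
rewrite hornerD hornerN hornerM mulrBr IH1 mulrCA IH2 /T.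
rewrite !(hornerD, hornerN, hornerM, hornerC, hornerX) /y.
have -> : (2 * k.+2).+1 = ((2 * k).+1 + 4)%N by lia.
have -> : (2 * k.+1).+1 = ((2 * k).+1 + 2)%N by lia.
rewrite !exprD !exprS; have := expf_neq0 (2 * k) E0.
move: (E ^+ (2 * k)) ((-1) ^+ k) => G s G0; field.
by rewrite E0 G0.
Qed.

(** Let [theta = ln E], [a = tanh^2 theta] and [S = sinh((2k+1) theta)]. The polynomial
    [h = (X - a L) p^2] is at most [(1 - a) L] on [[0, L]] and equals [- (1 - a) L S^2] at 0. As
    [z.Mz - a L z.z = v.h(M)v], a large enough overlap of [v] with [u] makes this nonpositive; [z]
    is normalised at the end. *)
Lemma cheb_eigenvector (R : realType) n (M : 'M[R]_n.+1) (u v : 'cV[R]_n.+1) (L E : R) k :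
  M^T = M -> (forall a, eigenvalue M a -> 0 <= a <= L) -> 0 < L ->
  M *m u = 0 -> dot u u = 1 -> dot v v = 1 -> 1 < E ->
  2 <= `|dot u v| * E ^+ (2 * k).+1 ->
  exists2 p : {poly R}, (size p <= k.+1)%N &
    let z := horner_mx M p *m v in
    dot z z = 1 /\ dot z (M *m z) <= L * ((E ^+ 2 - 1) / (E ^+ 2 + 1)) ^+ 2.
Proof.
move=> sM eigM L0 Mu uu vv E1 big.
have E0 : 0 < E by rewrite (lt_trans _ E1).
have En0 : E != 0 by rewrite gt_eqF.
have E21 : 0 < E ^+ 2 - 1 by rewrite subr_gt0 exprn_egt1.
have E22 : 0 < E ^+ 2 + 1 by lra.
pose s : R := (E ^+ 2 - 1) / (E ^+ 2 + 1).
have s0 : 0 < s by rewrite divr_gt0.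
have s1 : s < 1 by rewrite ltr_pdivrMr // mul1r; lra.
pose a := s ^+ 2; rewrite -/s -/a.
have a0 : 0 < a by rewrite exprn_gt0.
have a1 : a < 1 by rewrite exprn_ilt1 // ltW.
have a1' : 0 < 1 - a by rewrite subr_gt0.
pose y := (E - E^-1) / 2.
have y2 : y ^+ 2 = a / (1 - a).
  rewrite /y /a /s; field.
  rewrite En0 (gt_eqF E22) /= andbT.
  rewrite (_ : _ - _ = 4 * E ^+ 2); last by ring.
  by rewrite mulf_neq0 // expf_neq0.
pose S := (E ^+ (2 * k).+1 - E ^- (2 * k).+1) / 2.
have yS : y ^+ 2 * (cheb R k.+1).[- y ^+ 2] ^+ 2 = S ^+ 2.
  rewrite -exprMn cheb_growth // -mulrA -/S exprMn -exprM mulnC exprM sqrrN expr1n.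
  by rewrite expr1n mul1r.
pose c := dot u v.
have c1 : c ^+ 2 <= 1 by have := Cauchy_Schwarz u v; rewrite uu vv mulr1.
have c0 : 0 < `|c|.
  rewrite lt_def normr_ge0 andbT; apply: contraTneq big => ->.
  by rewrite mul0r -ltNge.
(* This says [|c| cosh((2k+1) theta) >= 1]. The hypothesis [|c| E^(2k+1) >= 2] controls both
   exponentials in [S], giving [|c| S >= 1 - c^2 / 4], which is then squared. *)
have SB : 1 - c ^+ 2 <= c ^+ 2 * S ^+ 2.
  have G0 : 0 < E ^+ (2 * k).+1 by rewrite exprn_gt0.
  have cS : 1 - c ^+ 2 / 4 <= `|c| * S.
    have h1 : E ^- (2 * k).+1 <= `|c| / 2.
      rewrite -(ler_pM2l G0) mulfV ?gt_eqF //; move: big; rewrite -/c; lra.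
    have h2 : `|c| * E ^- (2 * k).+1 <= `|c| * (`|c| / 2) by rewrite ler_wpM2l // ltW.
    have h3 : `|c| * `|c| = c ^+ 2 by rewrite -expr2 real_normK ?num_real.
    rewrite mulrA h3 in h2; rewrite /S mulrA mulrBr; move: big; rewrite -/c; lra.
  have : (1 - c ^+ 2 / 4) ^+ 2 <= (`|c| * S) ^+ 2.
    by rewrite ler_sqr ?nnegrE //; [lra | apply: le_trans cS; lra].
  rewrite exprMn real_normK ?num_real //; apply: le_trans.
  have := sqr_ge0 c; have := sqr_ge0 (c ^+ 2 / 4); rewrite sqrrB; lra.
(* The affine map carrying [a L] to 0 and [L] to 1; it sends the eigenvalue 0 to [- y^2]. *)
pose lin : {poly R} := (L * (1 - a))^-1 *: 'X - (a / (1 - a))%:P.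
pose p := cheb R k.+1 \Po lin.
have linE l : lin.[l] = (l / L - a) / (1 - a).
  by rewrite /lin !hornerE; field; rewrite !gt_eqF.
have pE l : p.[l] = (cheb R k.+1).[(l / L - a) / (1 - a)].
  by rewrite /p horner_comp linE.
have sp : (size p <= k.+1)%N.
  rewrite (leq_trans (size_comp_poly_leq _ _)) //.
  have -> : (size lin).-1 = 1%N.
    rewrite /lin -polyCN size_addl size_scale ?size_polyX ?invr_eq0 ?mulf_neq0 ?gt_eqF //.
    by rewrite ltnS size_polyC_leq1.
  by have := size_cheb R k; case: (size _) => [|j] //=; rewrite muln1.
pose h := ('X - (a * L)%:P) * p ^+ 2.
have hE l : h.[l] = (l - a * L) * p.[l] ^+ 2.
  by rewrite /h !hornerE.
have e0 : (0 / L - a) / (1 - a) = - y ^+ 2 by rewrite y2; ring.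
have h0E : h.[0] = - ((1 - a) * L * S ^+ 2).
  by rewrite hE pE e0 -yS y2; field; rewrite gt_eqF.
(* Between [a L] and [L] the Chebyshev bound applies; below [a L] the value of [h] is
   nonpositive. *)
have hb l : 0 <= l <= L -> h.[l] <= (1 - a) * L.
  move=> /andP[l0 lL]; rewrite hE pE.
  have -> : l - a * L = (1 - a) * L * ((l / L - a) / (1 - a)) by field; rewrite !gt_eqF.
  have lL' : (l / L - a) / (1 - a) <= 1.
    by rewrite ler_pdivrMr // mul1r lerB // ler_pdivrMr // mul1r.
  rewrite -[leLHS]mulrA -[leRHS]mulr1 ler_wpM2l; [by []|by rewrite mulr_ge0 ?ltW|].
  move: lL'; set x := (l / L - a) / (1 - a) => x1.
  have [x0|x0] := leP 0 x; first by rewrite cheb_bound ?x0.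
  by rewrite (le_trans _ ler01) // mulr_le0_ge0 ?sqr_ge0 // ltW.
pose z := horner_mx M p *m v.
have zhz : dot z (M *m z) - a * L * dot z z = dot v (horner_mx M h *m v).
  have cM (x : 'cV_n.+1) : horner_mx M p *m (M *m x) = M *m (horner_mx M p *m x).
    by have := horner_mxM_mul M p 'X x; rewrite mulrC horner_mxM_mul horner_mx_X.
  rewrite /h !horner_mxM_mul rmorphB /= horner_mx_X horner_mx_C mulmxBl mul_scalar_mx.
  rewrite dotDr dotNr dotZr /z !dot_mxl horner_mx_sym // cM.
  by [].
pose w := v - c *: u.
have uw : dot u w = 0 by rewrite /w !dotL uu -/c; ring.
have vE : v = c *: u + w by rewrite /w addrC subrK.
have ww : dot w w = 1 - c ^+ 2 by rewrite /w !dotL uu vv (dotC v u) -/c; ring.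
have Mu0 : M *m u = 0 *: u by rewrite scale0r.
clearbody w.
(* [u] is an eigenvector of [h(M)] orthogonal to [w], so the cross terms vanish. *)
have vhv : dot v (horner_mx M h *m v) = c ^+ 2 * h.[0] + dot w (horner_mx M h *m w).
  rewrite {1 2}vE mulmxDr -scalemxAr (horner_mx_eigen h Mu0) !dotL uu.
  rewrite (dotC w u) uw -(horner_mx_sym h sM) -dot_mxl (horner_mx_eigen h Mu0) dotZl uw; ring.
have [l eigl /(_ w) [m m0 spec]] := spectral_measure sM.
have whw : dot w (horner_mx M h *m w) <= (1 - a) * L * dot w w.
  have mw : dot w w = \sum_i m i.
    have := spec 1; rewrite rmorph1 mulmx1 -/(dot w w) => ->.
    by apply: eq_bigr => i _; rewrite hornerC mul1r.
  rewrite /dot mulmxA spec -/(dot w w) mw mulr_sumr ler_sum // => i _.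
  by rewrite ler_wpM2r // hb // eigM.
have zle : dot z (M *m z) <= L * a * dot z z.
  rewrite -subr_le0 [L * a]mulrC zhz vhv h0E.
  rewrite ww in whw; have := ler_wpM2l (ltW (mulr_gt0 a1' L0)) SB; lra.
(* The component of [z] along [u] is [c p(0)], and [y^2 p(0)^2 = S^2 > 0]. *)
have zn0 : z != 0.
  have S0 : 0 < S ^+ 2.
    rewrite lt_def sqr_ge0 andbT; apply/negP => /eqP S0.
    rewrite S0 mulr0 in SB; have {}c1 : c ^+ 2 = 1 by apply/eqP; rewrite eq_le c1 /=; lra.
    have : 1 < E ^+ (2 * k).+1 by rewrite exprn_egt1.
    move: S0 => /eqP; rewrite sqrf_eq0 /S mulf_eq0 invr_eq0 pnatr_eq0 orbF subr_eq0 => /eqP GG.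
    move=> G1; have : E ^- (2 * k).+1 < 1 by rewrite invf_lt1 // (lt_trans _ G1).
    by rewrite -GG ltNge ltW.
  apply: contraTneq S0 => z0; rewrite -yS.
  have : dot u z = c * p.[0].
    by rewrite /z -(horner_mx_sym p sM) -dot_mxl (horner_mx_eigen p Mu0) dotZl mulrC.
  rewrite z0 dotC dot0l pE e0 => /esym/eqP.
  rewrite mulf_eq0 -normr_eq0 gt_eqF //= => /eqP ->.
  by rewrite expr0n mulr0 ltxx.
have zz : 0 < dot z z by rewrite lt_def dot_eq0 zn0 dot_ge0.
pose N := Num.sqrt (dot z z).
have N2 : N ^+ 2 = dot z z by rewrite sqr_sqrtr ?dot_ge0.
have N0 : 0 < N by rewrite sqrtr_gt0.
exists (N^-1 *: p); first by rewrite (leq_trans (size_scale_leq _ _)).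
rewrite /= horner_mxZ -scalemxAl -/z -scalemxAr !dotL !(mulrA N^-1 N^-1) -expr2 exprVn N2 -/s -/a.
split; first by rewrite mulVf // gt_eqF.
by rewrite mulrC ler_pdivrMr.
Qed.

(** * A bound on the hyperbolic tangent *)

(** The left-hand side starts the power series of [2 artanh y], the right-hand side. The difference
    has derivative [2 z^4 / (1 - z^2)], and the mean value theorem concludes. *)
Lemma artanh_ge (R : realType) (y : R) : 0 <= y < 1 ->
  2 * y + 2 / 3 * y ^+ 3 <= ln (1 + y) - ln (1 - y).
Proof.
move=> /andP[y0 y1].
pose f (z : R) := ln (1 + z) - ln (1 - z) - (2 * z + 2 / 3 * z ^+ 3).
pose f' (z : R) := (1 + z)^-1 + (1 - z)^-1 - (2 + 2 * z ^+ 2).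
have df (z : R) : z \in `]-1, 1[%R -> is_derive z 1 f (f' z).
  rewrite in_itv /= => /andP[z0 z1].
  have d1 : is_derive z 1 (fun w => ln (1 + w)) (1 + z)^-1.
    have h : is_derive (1 + z) 1 (@ln R) (1 + z)^-1 by apply: is_derive1_ln; lra.
    have := @is_derive1_comp R (@ln R) (fun w => 1 + w) z _ 1 h.
    rewrite mulr1; apply; by apply: is_derive_eq; rewrite /GRing.scale /=; ring.
  have d2 : is_derive z 1 (fun w => ln (1 - w)) (- (1 - z)^-1).
    have h : is_derive (1 - z) 1 (@ln R) (1 - z)^-1 by apply: is_derive1_ln; lra.
    have := @is_derive1_comp R (@ln R) (fun w => 1 - w) z _ (-1) h.
    rewrite mulrN1; apply; by apply: is_derive_eq; rewrite /GRing.scale /=; ring.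
  have d3 : is_derive z 1 (fun w : R => 2 * w + 2 / 3 * w ^+ 3) (2 + 2 * z ^+ 2).
    by apply: is_derive_eq; rewrite /GRing.scale /=; field.
  have := is_deriveB (is_deriveB d1 d2) d3; rewrite opprK; exact.
have cf : {within `[0, y], continuous f}.
  apply: derivable_within_continuous => z; rewrite in_itv /= => /andP[z0 zy].
  by have [] := df z _; rewrite // in_itv /=; apply/andP; split; lra.
have dfy z : z \in `]0, y[%R -> is_derive z 1 f (f' z).
  by rewrite in_itv /= => /andP[z0 zy]; apply: df; rewrite in_itv /=; apply/andP; split; lra.
have [c] := @MVT_segment R f f' 0 y y0 dfy cf.
rewrite in_itv /= => /andP[c0 cy] fE.
have f0 : f 0 = 0 by rewrite /f addr0 subr0 ln1 expr0n /= !mulr0 addr0 !subr0.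
have f'0 : 0 <= f' c.
  have c1 : 0 < 1 - c by lra.
  have c2 : 0 < 1 + c by lra.
  have -> : f' c = 2 * c ^+ 4 / ((1 + c) * (1 - c)).
    by rewrite /f'; field; rewrite !gt_eqF.
  by apply: divr_ge0; apply: mulr_ge0; rewrite ?exprn_ge0 ?(ltW c1) ?(ltW c2).
have : 0 <= f y - f 0 by rewrite fE mulr_ge0 // subr0.
by rewrite f0 subr0 /f subr_ge0.
Qed.

(** With [s = tanh(l / m)], [artanh_ge] gives [s^2 (1 + 2/3 s^2) <= (l / m)^2], enough if [N <= m].
    If [N = m + 1], the excess [(2m + 1) s^2] is paid by the quartic term and the summand 4. *)
Lemma tanh_bound (R : realType) (l N m : R) : 0 <= l -> 0 < m -> 1 <= N ->
  N <= m \/ (1 <= m /\ N = m + 1) ->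
  ((expR (l / m) ^+ 2 - 1) / (expR (l / m) ^+ 2 + 1)) ^+ 2 <= (l ^+ 2 + 4) / N ^+ 2.
Proof.
move=> l0 m0 N1 Nm; set E := expR (l / m); pose x := l / m; pose s := (E ^+ 2 - 1) / (E ^+ 2 + 1).
have x0 : 0 <= x by rewrite divr_ge0 // ltW.
have E1 : 1 <= E by rewrite -expR0 ler_expR.
have E2 : 1 <= E ^+ 2 by rewrite exprn_ege1.
have s0 : 0 <= s by rewrite divr_ge0 //; lra.
have s1 : s < 1 by rewrite ltr_pdivrMr; lra.
have lx : l = m * x by rewrite /x mulrC divfK ?gt_eqF.
have : 2 * s + 2 / 3 * s ^+ 3 <= 2 * x.
  have -> : 2 * x = ln (1 + s) - ln (1 - s).
    rewrite -ln_div ?posrE; [|lra|lra].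
    have -> : (1 + s) / (1 - s) = E ^+ 2.
      rewrite /s; field; apply/andP; split; first by apply: lt0r_neq0; lra.
      by rewrite (_ : _ - _ = 2) ?pnatr_eq0 //; ring.
    by rewrite /E -expRM_natl expRK.
  by apply: artanh_ge; rewrite s0.
rewrite -/s ler_pdivlMr; last by rewrite exprn_gt0 //; lra.
rewrite lx [(m * x) ^+ 2]exprMn => sx; clearbody s.
have h : s ^+ 2 * (1 + 2 / 3 * s ^+ 2) <= x ^+ 2.
  have : (s + s ^+ 3 / 3) ^+ 2 <= x ^+ 2.
    rewrite ler_sqr ?nnegrE //; last by rewrite addr_ge0 // divr_ge0 // exprn_ge0.
    by lra.
  have := sqr_ge0 (s ^+ 3 / 3); rewrite sqrrD.
  rewrite (_ : s ^+ 2 * _ = s ^+ 2 + 2 / 3 * (s * s ^+ 3)); last by ring.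
  rewrite (_ : s * (s ^+ 3 / 3) = s * s ^+ 3 / 3); last by ring.
  by lra.
have S0 := sqr_ge0 s.
move: h S0; move: (s ^+ 2) (x ^+ 2) => S X h S0.
have hm : m ^+ 2 * (S * (1 + 2 / 3 * S)) <= m ^+ 2 * X by rewrite ler_wpM2l ?sqr_ge0.
case: Nm => [Nm|[m1 ->]].
  have : S * N ^+ 2 <= m ^+ 2 * S.
    by rewrite mulrC ler_wpM2r // ler_sqr ?nnegrE //; lra.
  have := mulr_ge0 (sqr_ge0 (m * S)) (_ : 0 <= 2 / 3 :> R).
  rewrite divr_ge0 // => /(_ isT); rewrite exprMn; lra.
have h1 : S * (m + 1) ^+ 2 = m ^+ 2 * S + (2 * m * S + S) by ring.
have h2 : S <= m * S by rewrite -[leLHS]mul1r ler_wpM2r.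
(* With [q = m S] what remains is at most [3 q - 2/3 q^2], and this square bounds it by
   [3.84 - q / 5]. *)
have h3 := sqr_ge0 (m * S - 24 / 10).
have h4 : (m * S - 24 / 10) ^+ 2 = m ^+ 2 * (S * S) - 48 / 10 * (m * S) + 576 / 100 by field.
have h5 : 0 <= m * S by rewrite mulr_ge0 // ltW.
rewrite h1; rewrite h4 in h3.
have h6 : m ^+ 2 * (S * (1 + 2 / 3 * S)) = m ^+ 2 * S + 2 / 3 * (m ^+ 2 * (S * S)) by field.
rewrite h6 in hm; lra.
Qed.

(** The line through [x] along [z] meets the sphere at [a = - p + D >= 0] and [a = - p - D <= 0], as
    [D >= |p|]; the root is chosen against the sign of [g]. Chords of the ball have length at most
    [2 r]. *)
Lemma sphere_step (R : realType) n (x z : 'cV[R]_n) (r g : R) :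
  dot z z = 1 -> dot x x <= r ^+ 2 ->
  exists a : R, [/\ dot (x + a *: z) (x + a *: z) = r ^+ 2, a * g <= 0 & a ^+ 2 <= 4 * r ^+ 2].
Proof.
move=> zz xr; set p := dot x z.
pose D := Num.sqrt (p ^+ 2 + (r ^+ 2 - dot x x)).
have D2 : D ^+ 2 = p ^+ 2 + (r ^+ 2 - dot x x).
  by rewrite sqr_sqrtr // addr_ge0 ?sqr_ge0 ?subr_ge0.
have pD : `|p| <= D.
  by rewrite -ler_sqr ?nnegrE ?sqrtr_ge0 // D2 real_normK ?num_real // lerDl subr_ge0.
move: pD; rewrite ler_norml => /andP[pD1 pD2].
have main a : a = - p + D \/ a = - p - D ->
    dot (x + a *: z) (x + a *: z) = r ^+ 2 /\ a ^+ 2 <= 4 * r ^+ 2.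
  move=> aE; have aE2 : (a + p) ^+ 2 = D ^+ 2.
    by case: aE => ->; ring.
  split.
    rewrite !dotL zz (dotC z x) -/p.
    have -> : dot x x + a * p + (a * p + a * (a * 1)) = dot x x + ((a + p) ^+ 2 - p ^+ 2) by ring.
    by rewrite aE2 D2; ring.
  have px : p ^+ 2 <= dot x x by have := Cauchy_Schwarz x z; rewrite zz mulr1.
  rewrite D2 in aE2; have := sqr_ge0 (a + 2 * p).
  have -> : (a + 2 * p) ^+ 2 = 2 * (a + p) ^+ 2 + 2 * p ^+ 2 - a ^+ 2 by ring.
  by rewrite aE2; lra.
have [g0|g0] := leP g 0.
  exists (- p + D); have [//|h1 h2] := main (- p + D); first by left.
  split=> //; apply: mulr_ge0_le0 => //; lra.
exists (- p - D); have [//|h1 h2] := main (- p - D); first by right.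
split=> //; apply: mulr_le0_ge0; [lra | exact: ltW].
Qed.

(** * The gap for a fixed direction *)

Lemma quad_shift (R : realType) n (A : 'M[R]_n) (b x : 'cV[R]_n) l :
  quad A b x = quad (A - l%:M) b x + l / 2 * dot x x.
Proof. by rewrite !quadE mulmxBl mul_scalar_mx dotDr dotNr dotZr; field. Qed.

Lemma shift_eigenvalue (R : fieldType) n (A : 'M[R]_n) (a l : R) :
  eigenvalue (A - l%:M) a -> eigenvalue A (a + l).
Proof.
move=> /eigenvalueP[w wA w0]; apply/eigenvalueP; exists w => //.
by rewrite scalerDl -wA mulmxBr mul_mx_scalar subrK.
Qed.

Lemma shift_horner (R : comNzRingType) n (A : 'M[R]_n.+1) (l : R) (p : {poly R}) :
  horner_mx (A - l%:M) p = horner_mx A (p \Po ('X - l%:P)).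
Proof. by rewrite horner_mx_comp rmorphB /= horner_mx_X horner_mx_C. Qed.

(** Composition with [X - l] does not change the degree. *)
Lemma krylov_shift (R : realType) n (A : 'M[R]_n.+1) (u : 'cV[R]_n.+1) l (p : {poly R}) k :
  (size p <= k)%N -> horner_mx (A - l%:M) p *m u \in <<krylov A u k>>%VS.
Proof.
move=> pk; apply/krylov_spanP; rewrite shift_horner.
by exists (p \Po ('X - l%:P)) => //; rewrite size_comp_poly2 // size_XsubC.
Qed.

Lemma eigen_bounds (R : realType) n (M : 'M[R]_n.+1) L : M^T = M ->
  (forall a, eigenvalue M a -> 0 <= a <= L) ->
  forall w, 0 <= dot w (M *m w) <= L * dot w w.
Proof.
move=> sM eigM w; have [l eigl /(_ w) [m m0 spec]] := spectral_measure sM.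
have mw : dot w w = \sum_i m i.
  have := spec 1; rewrite rmorph1 mulmx1 -/(dot w w) => ->.
  by apply: eq_bigr => i _; rewrite hornerC mul1r.
have -> : dot w (M *m w) = \sum_i l i * m i.
  rewrite /dot mulmxA; have := spec 'X; rewrite horner_mx_X => ->.
  by apply: eq_bigr => i _; rewrite hornerX.
rewrite mw mulr_sumr; apply/andP; split.
  by apply: sumr_ge0 => i _; rewrite mulr_ge0 //; have /andP[] := eigM _ (eigl i).
by apply: ler_sum => i _; rewrite ler_wpM2r //; have /andP[] := eigM _ (eigl i).
Qed.

Lemma divn2_bound t k : (t %/ 2)%N = k.+1 -> (t <= (2 * k).+3)%N.
Proof. lia. Qed.

(** Taking [E^(2k+1) = 2 / rho] with [k + 1 = floor(t / 2)] meets the overlap condition of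
    [cheb_eigenvector] whenever [|u.v| >= rho]. *)
Lemma krylov_eigenvector (R : realType) n (M : 'M[R]_n.+1) (u v : 'cV[R]_n.+1)
    (L rho : R) (t : nat) :
  M^T = M -> (forall a, eigenvalue M a -> 0 <= a <= L) -> 0 <= L ->
  M *m u = 0 -> dot u u = 1 -> dot v v = 1 -> 0 < rho <= 1 -> rho <= `|dot u v| ->
  (2 <= t)%N ->
  exists2 p : {poly R}, (size p <= t %/ 2)%N &
    let z := horner_mx M p *m v in
    dot z z = 1 /\ dot z (M *m z) <= L * ((ln (2 / rho) ^+ 2 + 4) / (t%:R - 1) ^+ 2).
Proof.
move=> sM eigM L0 Mu uu vv /andP[rho0 rho1] rhov t2.
have t1 : 1 <= t%:R - 1 :> R by have : (2%:R : R) <= t%:R by [rewrite ler_nat]; lra.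
have k0 : (0 < t %/ 2)%N by rewrite divn_gt0.
have l1 : 1 < 2 / rho by rewrite ltr_pdivlMr //; lra.
have l0 : 0 < ln (2 / rho) by rewrite ln_gt0.
have := L0; rewrite le_eqVlt => /predU1P[L0'|Lgt0].
  (* For [L = 0] the form of [M] vanishes and [v] itself serves. *)
  exists 1; first by rewrite size_poly1.
  rewrite /= rmorph1 mul1mx vv -L0' mul0r; split=> //.
  by have /andP[_] := eigen_bounds sM eigM v; rewrite -L0' mul0r.
case kE : (t %/ 2)%N k0 => [//|k] _.
pose m : nat := (2 * k).+1.
have m0 : (0 : R) < m%:R by rewrite ltr0n.
pose E := expR (ln (2 / rho) / m%:R).
have E1 : 1 < E by rewrite expR_gt1 divr_gt0.
have EG : E ^+ m = 2 / rho.
  rewrite -expRM_natl mulrC divfK ?gt_eqF // lnK // posrE; lra.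
have [|p sp /= [zz zMz]] := cheb_eigenvector sM eigM Lgt0 Mu uu vv E1 (k := k).
  rewrite -/m EG mulrA ler_pdivlMr // mulrC.
  by rewrite ler_wpM2r.
exists p => //=; split=> //; apply: le_trans zMz _; rewrite ler_wpM2l //.
apply: tanh_bound => //; first exact: ltW.
(* [t - 1] is [m] for even [t] and [m + 1] for odd [t]. *)
have [tm|tm] := leqP t m.+1; first by left; rewrite lerBlDr natr1 ler_nat.
right; have -> : t = m.+2 by apply/eqP; rewrite eqn_leq tm andbT /m (divn2_bound kE).
split; first by rewrite ler1n.
by rewrite -[m.+2]addn2 natrD; lra.
Qed.

(** The deterministic half of the argument: [v] enters through the lower bound [rho] on its overlap
    with the bottom eigenvector [u], a condition tied to [lmin < 0] because only then is the Krylov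
    space of [v] exploited. *)
Lemma krylov_gap (R : realType) n (A : 'M[R]_n.+1) (b : 'cV[R]_n.+1)
    (r lmin lmax rho : R) (xs s u v : 'cV[R]_n.+1) (t : nat) :
  A^T = A -> 0 < r ->
  smallest_eigenvalue A lmin -> largest_eigenvalue A lmax ->
  dot xs xs <= r ^+ 2 -> (2 <= t)%N ->
  is_argmin (quad A b)
       [set x | x \in <<krylov A b (t %/ 2) ++ krylov A v (t %/ 2)>>%VS /\ enorm x <= r] s ->
  A *m u = lmin *: u -> dot u u = 1 ->
  (lmin < 0 -> dot v v = 1 /\ rho <= `|dot u v|) -> 0 < rho <= 1 ->
  quad A b s - quad A b xs <= (lmax - lmin) * r ^+ 2 / (t%:R - 1) ^+ 2 *
      (16 + 2 * (lmin < 0)%R%:R * ln (2 / rho) ^+ 2).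
Proof.
move=> sA r0 [eigmin minle] [eigmax maxge] xsr t2 [_ sopt] Au uu vrho rho01.
pose L := lmax - lmin; pose M := A - lmin%:M.
have sM : M^T = M by rewrite /M linearB /= sA tr_scalar_mx.
have L0 : 0 <= L by rewrite subr_ge0 maxge.
have eigM a : eigenvalue M a -> 0 <= a <= L.
  move=> /shift_eigenvalue ea; rewrite /L lerBrDr maxge // andbT.
  by have := minle _ ea; lra.
have Mu : M *m u = 0 by rewrite /M mulmxBl mul_scalar_mx Au subrr.
have t1 : 1 <= t%:R - 1 :> R by have : (2%:R : R) <= t%:R by [rewrite ler_nat]; lra.
have r2 : 0 < r ^+ 2 by rewrite exprn_gt0.
set T := (t%:R - 1) ^+ 2 : R.
have T0 : 0 < T by rewrite exprn_gt0 //; lra.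
set k := (t %/ 2)%N in sopt *.
(* From [t <= 2k + 1]: [(t - 1)^2 <= (2k)^2 <= 4k(k + 1)], which turns the rate of [accel] into
   [8 L r^2 / (t - 1)^2]. *)
have kT : T <= 4 * (k%:R * (k%:R + 1)).
  have kt : (t <= 2 * k + 1)%N by rewrite {1}(divn_eq t 2) mulnC leq_add2l -ltnS ltn_pmod.
  have : t%:R - 1 <= 2 * k%:R :> R.
    by move: kt; rewrite -(ler_nat R) natrD natrM; lra.
  have : 0 <= (k%:R : R) by exact: ler0n.
  rewrite /T; move: (t%:R - 1) t1 (k%:R : R) => x x1 y y0 xy.
  have : x ^+ 2 <= (2 * y) ^+ 2 by rewrite ler_sqr ?nnegrE; lra.
  by rewrite exprMn; lra.
(* With this [mu], [F] below is the objective itself if [lmin >= 0] and its convex part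
   otherwise. *)
pose mu := Num.max lmin 0.
have mu0 : 0 <= mu by rewrite le_max lexx orbT.
have sopt' y z : y \in <<krylov A b k>>%VS -> z \in <<krylov A v k>>%VS ->
    dot (y + z) (y + z) <= r ^+ 2 -> quad A b s <= quad A b (y + z).
  move=> yK zK yz; apply: sopt; split; last by rewrite enorm_le // ltW.
  by rewrite span_cat memv_add.
have [p [q /= [sp _ xr _ gap]]] := accel b sM (eigen_bounds sM eigM) mu0 L0 r0 k.
set x := horner_mx M p *m b in xr gap.
have xK : x \in <<krylov A b k>>%VS by exact: krylov_shift.
have Q0 : 0 <= L * r ^+ 2 / T.
  by apply: divr_ge0; [apply: mulr_ge0 => //; exact: ltW | exact: ltW].
pose F w := quad M b w + mu / 2 * dot w w.
have {}gap : F x - F xs <= L * r ^+ 2 / T * 8.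
  have h := gap _ xsr; rewrite -/(F x) -/(F xs) in h.
  have h1 : L / 2 * dot xs xs <= L / 2 * r ^+ 2 by rewrite ler_wpM2l ?divr_ge0.
  have h2 : 0 <= L / 2 * dot (xs - horner_mx M q *m b) (xs - horner_mx M q *m b).
    by rewrite mulr_ge0 ?dot_ge0 ?divr_ge0.
  have {h h1 h2} : (4 * (k%:R * (k%:R + 1))) * (F x - F xs) <= 8 * L * r ^+ 2 by lra.
  have [D0|D0] := leP (F x - F xs) 0.
    by move=> _; apply: le_trans D0 _; rewrite mulr_ge0.
  move=> h; rewrite mulrAC ler_pdivlMr // mulrC [leRHS]mulrC mulrA.
  by apply: le_trans h; rewrite ler_wpM2r // ltW.
have [lm|lm] := ltP lmin 0; last first.
  rewrite mulr0 mul0r addr0.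
  have muE : mu = lmin by rewrite /mu; apply/max_idPl.
  have FE w : F w = quad A b w by rewrite (quad_shift A b w lmin) /F muE.
  have := sopt' x 0 xK (mem0v _); rewrite addr0 => /(_ xr); rewrite -!FE => h.
  by rewrite -/L; lra.
have muE : mu = 0 by rewrite /mu; apply/max_idPr/ltW.
have FE w : F w = quad M b w by rewrite /F muE !mul0r addr0.
rewrite !FE in gap.
have [vv rhov] := vrho lm.
have [p' sp' /= [zz zMz]] := krylov_eigenvector sM eigM L0 Mu uu vv rho01 rhov t2.
set z := horner_mx M p' *m v in zz zMz.
have zK a : a *: z \in <<krylov A v k>>%VS by rewrite memvZ // krylov_shift.
(* [M *m x + b] is the gradient of the convex part at [x], so [ag] makes the first-order change
   nonpositive. *)
have [a [yr ag a2]] := sphere_step (dot (M *m x + b) z) zz xr.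
have := sopt' x (a *: z) xK (zK a); rewrite yr lexx => /(_ isT).
rewrite (quad_shift A b (x + a *: z) lmin) (quad_shift A b xs lmin) yr.
rewrite (quad_expand b sM (x + a *: z) x) (addrC x) addrK -scalemxAr !dotZr dotZl.
rewrite mulr1n mulr1 -/L -/T.
have h1 : a ^+ 2 * dot z (M *m z) <= 4 * r ^+ 2 * (L * ((ln (2 / rho) ^+ 2 + 4) / T)).
  apply: le_trans (ler_wpM2l (sqr_ge0 a) zMz) _; rewrite -/T ler_wpM2r //.
  by rewrite mulr_ge0 // divr_ge0 ?addr_ge0 ?sqr_ge0 // ltW.
(* The new point has norm [r], so the concave term is no larger there than at [xs]. *)
have h2 : lmin / 2 * r ^+ 2 <= lmin / 2 * dot xs xs.
  by rewrite ler_wnM2l //; lra.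
(* The constant 16 is 8 from acceleration plus [2 * 4] from the summand 4 of [tanh_bound]. *)
have -> : L * r ^+ 2 / T * (16 + 2 * ln (2 / rho) ^+ 2) =
  L * r ^+ 2 / T * 8 + 2^-1 * (4 * r ^+ 2 * (L * ((ln (2 / rho) ^+ 2 + 4) / T))).
  by field; exact: lt0r_neq0.
rewrite (mulrA a a) -expr2 /M.
lra.
Qed.

(** * Averages over the sphere *)

Lemma borel_measurable (R : realType) n (f : 'cV[R]_n.+1 -> R) :
  continuous f -> measurable_fun setT (f : borel_cV R n.+1 -> R).
Proof.
move=> /continuousP cf; apply: (measurability _ (measurable_realfun.RGenOpens.measurableE R)).
move=> _ [_ [a [b ->]] <-]; rewrite setTI; apply: sub_sigma_algebra.
by apply: cf; exact: interval_open.
Qed.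

Lemma continuous_coord (R : realType) n (i : 'I_n.+1) :
  continuous (fun x : 'cV[R]_n.+1 => x i 0 : R).
Proof. by move=> x; exact: coord_continuous. Qed.

Lemma continuous_add (R : realType) (T : topologicalType) (f g : T -> R) :
  continuous f -> continuous g -> continuous (fun x => f x + g x).
Proof. by move=> cf cg x; apply: cvgD; [exact: cf | exact: cg]. Qed.

Lemma continuous_mul (R : realType) (T : topologicalType) (f g : T -> R) :
  continuous f -> continuous g -> continuous (fun x => f x * g x).
Proof. by move=> cf cg x; apply: cvgM; [exact: cf | exact: cg]. Qed.

Lemma continuous_abs (R : realType) (T : topologicalType) (f : T -> R) :
  continuous f -> continuous (fun x => `|f x|).
Proof. by move=> cf x; apply: cvg_norm; exact: cf. Qed.

Lemma continuous_cst (R : realType) (T : topologicalType) (k : R) :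
  continuous (fun _ : T => k).
Proof. by move=> x; exact: cst_continuous. Qed.

Lemma continuous_sum (R : realType) (T : topologicalType) m (f : 'I_m -> T -> R) :
  (forall i, continuous (f i)) -> continuous (fun x => \sum_i f i x).
Proof.
move=> cf; elim: m f cf => [|m IH] f cf x.
  by under eq_fun do rewrite big_ord0; exact: cst_continuous.
under eq_fun do rewrite big_ord_recr /=; apply: cvgD; last exact: cf.
by apply: (IH (fun i => f (widen_ord (leqnSn m) i))) => i; exact: cf.
Qed.

Lemma continuous_dot (R : realType) (T : topologicalType) n (f g : T -> 'cV[R]_n.+1) :
  (forall i, continuous (fun x => f x i 0)) -> (forall i, continuous (fun x => g x i 0)) ->
  continuous (fun x => dot (f x) (g x)).
Proof.
move=> cf cg; under eq_fun do rewrite dotE.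
by apply: continuous_sum => i x; apply: cvgM; [exact: cf | exact: cg].
Qed.

Lemma continuous_affine_coord (R : realType) n (B : 'M[R]_n.+1) (c : 'cV[R]_n.+1) i :
  continuous (fun x : 'cV[R]_n.+1 => (c + B *m x) i 0 : R).
Proof.
have -> : (fun x : 'cV[R]_n.+1 => (c + B *m x) i 0) = (fun x => c i 0 + \sum_j B i j * x j 0).
  by apply/funext => x; rewrite !mxE.
apply: continuous_add; first exact: continuous_cst.
apply: continuous_sum => j; apply: continuous_mul; first exact: continuous_cst.
exact: continuous_coord.
Qed.

Lemma continuous_cV (R : realType) (T : topologicalType) n (f : T -> 'cV[R]_n.+1) :
  (forall i, continuous (fun x => f x i 0)) -> continuous f.
Proof.
move=> cf x A [P nP PA]; rewrite /=.
have : \forall y \near x, forall i, P i 0 (f y i 0).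
  by apply: filter_forall => i; exact: (cf i x _ (nP i 0)).
by apply: filterS => y Py; apply: PA => i j; rewrite ord1.
Qed.

Lemma continuous_mulmx (R : realType) n (B : 'M[R]_n.+1) :
  continuous (fun x : 'cV[R]_n.+1 => B *m x).
Proof.
apply: continuous_cV => i; have := @continuous_affine_coord R n B 0 i.
by under eq_fun do rewrite add0r.
Qed.

Definition sphere (R : realType) n : set (borel_cV R n.+1) :=
  [set x : 'cV[R]_n.+1 | enorm x = 1].

Lemma sphereE (R : realType) n (x : 'cV[R]_n.+1) : sphere x <-> dot x x = 1.
Proof. exact: enorm_eq1. Qed.

Lemma measurable_sphere (R : realType) n : measurable (@sphere R n).
Proof.
have -> : @sphere R n = (fun x : 'cV[R]_n.+1 => dot x x) @^-1` [set 1].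
  by apply/seteqP; split => x /sphereE.
rewrite -[X in measurable X]setTI; apply: borel_measurable => //.
by apply: continuous_dot => i; exact: continuous_coord.
Qed.

Lemma sphere_coord (R : realType) n (x : 'cV[R]_n.+1) i : sphere x -> `|x i 0| <= 1.
Proof.
move=> /sphereE; rewrite dotE (bigD1 i) //= => xi.
rewrite -(ler_sqr (_ : _ \in Num.nneg)) ?nnegrE // real_normK ?num_real // expr1n -xi -expr2.
by rewrite lerDl sumr_ge0 // => j _; rewrite -expr2 sqr_ge0.
Qed.

(** A class of test functions closed under the operations used below: continuity gives Borel
    measurability, boundedness on the sphere gives integrability there. *)
Definition bcont (R : realType) n (f : 'cV[R]_n.+1 -> R) :=
  continuous f /\ exists K : R, forall x : 'cV[R]_n.+1, sphere x -> `|f x| <= K.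

Lemma bcont_cst (R : realType) n (k : R) : bcont (fun _ : 'cV[R]_n.+1 => k).
Proof. by split; [exact: continuous_cst | exists `|k|]. Qed.

Lemma bcont_coord (R : realType) n i : bcont (fun x : 'cV[R]_n.+1 => x i 0).
Proof. by split; [exact: continuous_coord | exists 1 => x /sphere_coord]. Qed.

Lemma bcontD (R : realType) n (f g : 'cV[R]_n.+1 -> R) :
  bcont f -> bcont g -> bcont (fun x => f x + g x).
Proof.
move=> [cf [K fK]] [cg [K' gK]]; split; first exact: continuous_add.
by exists (K + K') => x Sx; rewrite (le_trans (ler_normD _ _)) // lerD ?fK ?gK.
Qed.

Lemma bcontM (R : realType) n (f g : 'cV[R]_n.+1 -> R) :
  bcont f -> bcont g -> bcont (fun x => f x * g x).
Proof.
move=> [cf [K fK]] [cg [K' gK]]; split; first exact: continuous_mul.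
by exists (K * K') => x Sx; rewrite normrM ler_pM ?fK ?gK.
Qed.

Lemma bcontZ (R : realType) n (f : 'cV[R]_n.+1 -> R) k :
  bcont f -> bcont (fun x => k * f x).
Proof. by apply: bcontM; exact: bcont_cst. Qed.

Lemma bcontN (R : realType) n (f : 'cV[R]_n.+1 -> R) :
  bcont f -> bcont (fun x => - f x).
Proof. by move=> /(bcontZ (-1)); under eq_fun do rewrite mulN1r. Qed.

Lemma bcont_norm (R : realType) n (f : 'cV[R]_n.+1 -> R) :
  bcont f -> bcont (fun x => `|f x|).
Proof.
move=> [cf [K fK]]; split; first exact: continuous_abs.
by exists K => x Sx; rewrite normr_id fK.
Qed.

Lemma bcont_sum (R : realType) n m (f : 'I_m -> 'cV[R]_n.+1 -> R) :
  (forall i, bcont (f i)) -> bcont (fun x => \sum_i f i x).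
Proof.
elim: m f => [|m IH] f bf; first by under eq_fun do rewrite big_ord0; exact: bcont_cst.
by under eq_fun do rewrite big_ord_recl; apply: bcontD => //; exact: IH.
Qed.

(** Integration is restricted to the sphere, where the test functions are bounded and a uniform law
    has all its mass. *)
Definition avg (R : realType) n (mu : probability (borel_cV R n.+1) R)
    (f : 'cV[R]_n.+1 -> R) : R :=
  \int[mu]_(x in @sphere R n) (f x).

Lemma bcont_integrable (R : realType) n (mu : probability (borel_cV R n.+1) R) f :
  bcont f -> mu.-integrable (@sphere R n) (EFin \o f).
Proof.
move=> [cf [K fK]]; apply: measurable_bounded_integrable.
- exact: measurable_sphere.
- by apply: le_lt_trans (probability_le1 _ _) (ltry _); exact: measurable_sphere.
- by apply: (@measurable_funTS _ _ (borel_cV R n.+1)); exact: borel_measurable.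
- exists K; split; first exact: num_real.
  by move=> y Ky x Sx; apply: le_trans (fK x Sx) (ltW Ky).
Qed.

Lemma avgD (R : realType) n (mu : probability (borel_cV R n.+1) R) f g :
  bcont f -> bcont g -> avg mu (fun x => f x + g x) = avg mu f + avg mu g.
Proof.
by move=> bf bg; rewrite /avg RintegralD //;
  [exact: measurable_sphere | exact: bcont_integrable | exact: bcont_integrable].
Qed.

Lemma avgZ (R : realType) n (mu : probability (borel_cV R n.+1) R) k f :
  bcont f -> avg mu (fun x => k * f x) = k * avg mu f.
Proof.
by move=> bf; rewrite /avg RintegralZl //;
  [exact: measurable_sphere | exact: bcont_integrable].
Qed.

Lemma avg_cst (R : realType) n (mu : probability (borel_cV R n.+1) R) k :
  mu (@sphere R n) = 1%E -> avg mu (fun _ => k) = k.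
Proof.
move=> m1; rewrite /avg Rintegral_cst; last exact: measurable_sphere.
by transitivity (k * fine 1%E); [congr (k * fine _); exact: m1 | rewrite /= mulr1].
Qed.

Lemma avg_sum (R : realType) n (mu : probability (borel_cV R n.+1) R) m
    (f : 'I_m -> 'cV[R]_n.+1 -> R) :
  (forall i, bcont (f i)) -> avg mu (fun x => \sum_i f i x) = \sum_i avg mu (f i).
Proof.
elim: m f => [|m IH] f bf.
  under eq_fun do rewrite big_ord0; rewrite big_ord0.
  by have := avgZ mu 0 (bcont_cst n 0); rewrite !mul0r.
under eq_fun do rewrite big_ord_recl; rewrite avgD ?IH ?big_ord_recl //.
exact: bcont_sum.
Qed.

(** Change of variables along [phi]: the image of [mu] agrees with [mu] on Borel sets, and the
    sphere is its own preimage. *)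
Lemma avg_orthogonal (R : realType) n (mu : probability (borel_cV R n.+1) R) (Q : 'M[R]_n.+1) f :
  uniform_on_sphere mu -> Q^T *m Q = 1%:M -> bcont f ->
  avg mu (fun x => f (Q *m x)) = avg mu f.
Proof.
move=> [_ inv] QQ bf; rewrite /avg /Rintegral; congr fine.
pose phi (x : borel_cV R n.+1) : borel_cV R n.+1 := Q *m (x : 'cV[R]_n.+1).
have mphi : measurable_fun setT phi.
  apply: (@measurability _ _ (borel_cV R n.+1) (borel_cV R n.+1) setT phi (@open 'cV[R]_n.+1)) => // _ [B oB <-]; rewrite setTI.
  by apply: sub_sigma_algebra; move: B oB; apply/continuousP; exact: continuous_mulmx.
have Sphi' x : sphere x -> sphere (Q *m x).
  by move=> /sphereE h; apply/sphereE; rewrite dot_mxl mulmxA QQ mul1mx.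
have Sphi : phi @^-1` @sphere R n = @sphere R n.
  by apply/seteqP; split => x /sphereE h; apply/sphereE; move: h;
    rewrite /phi dot_mxl mulmxA QQ mul1mx.
rewrite -[in LHS]Sphi.
have := @integral_pushforward _ _ _ _ R phi mphi mu (@sphere R n) (EFin \o f).
rewrite /= => <-.
- by apply: eq_measure_integral => B mB _; exact: inv.
- by apply/measurable_EFinP; apply: borel_measurable; case: bf.
- rewrite Sphi; apply: (bcont_integrable mu (f := fun x => f (Q *m x))).
  case: bf => cf [K fK]; split; last by exists K => x /Sphi' /fK.
  by move=> x; apply: continuous_comp; [exact: continuous_mulmx | exact: cf].
- exact: measurable_sphere.
Qed.

(** * Openness in the random direction *)

(** This makes the success event measurable through [v] alone, [s] being an arbitrary selection of
    minimisers. For fixed polynomials the candidate point depends continuously on [v], and the set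
    is a union of open sets over all pairs of polynomials. *)
Lemma open_krylov_sublevel (R : realType) n (A : 'M[R]_n.+1) (b : 'cV[R]_n.+1) (r c : R) k :
  0 < r ->
  open [set v : 'cV[R]_n.+1 | exists2 x, quad A b x < c &
    x \in <<krylov A b k ++ krylov A v k>>%VS /\ enorm x <= r].
Proof.
move=> r0.
pose y (pq : {poly R} * {poly R}) (v : 'cV[R]_n.+1) := horner_mx A pq.1 *m b + horner_mx A pq.2 *m v.
have -> : [set v : 'cV[R]_n.+1 | exists2 x, quad A b x < c &
    x \in <<krylov A b k ++ krylov A v k>>%VS /\ enorm x <= r] =
  \bigcup_(pq in [set pq : {poly R} * {poly R} | (size pq.1 <= k)%N /\ (size pq.2 <= k)%N])
    ([set v | dot (y pq v) (y pq v) < r ^+ 2] `&` [set v | quad A b (y pq v) < c]).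
  apply/seteqP; split => v /=.
    move=> [x xc [xK xr]]; move: xr; rewrite enorm_le ?(ltW r0) // => xr.
    move: xK; rewrite span_cat => /memv_addP[_ /krylov_spanP[p pk ->] [_ /krylov_spanP[q qk ->] xE]].
    pose t := c - quad A b x.
    have t0 : 0 < t by rewrite subr_gt0.
    pose g := dot x (A *m x); pose l := dot b x.
    (* A point of norm [r] is shrunk to [(1 - e) x] to make the ball constraint strict. This raises
       the objective by less than [e K <= c - quad A b x]. *)
    pose K := `|g + l| + `|g| + 1.
    have K0 : 0 < K by rewrite /K ltr_wpDl ?addr_ge0.
    pose e : R := Num.min (2^-1) (t / K).
    have e0 : 0 < e by rewrite lt_min invr_gt0 ltr0n divr_gt0.
    have e1 : e <= 2^-1 by rewrite ge_min lexx.
    have et : e * K <= t by rewrite -ler_pdivlMr // ge_min lexx orbT.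
    have yE : y ((1 - e) *: p, (1 - e) *: q) v = (1 - e) *: x.
      by rewrite /y /= !horner_mxZ -!scalemxAl -scalerDr -xE.
    exists ((1 - e) *: p, (1 - e) *: q) => /=.
      by rewrite !(leq_trans (size_scale_leq _ _)).
    rewrite yE; split.
      rewrite dotZl dotZr mulrA -expr2.
      have e2 : (1 - e) ^+ 2 < 1 by rewrite expr_lt1 //; lra.
      apply: le_lt_trans (ler_wpM2l (sqr_ge0 _) xr) _.
      by rewrite -[ltRHS]mul1r ltr_pM2r // exprn_gt0.
    rewrite /= quadE -scalemxAr !dotZr dotZl -/g -/l.
    have -> : 2^-1 * ((1 - e) * ((1 - e) * g)) + (1 - e) * l =
      quad A b x - e * (g + l) + e * (e * g / 2) by rewrite quadE -/g -/l; field.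
    have h1 : - (g + l) <= `|g + l| by rewrite -normrN ler_norm.
    have h2 : e * g / 2 <= `|g|.
      have : e * g <= `|e * g| by exact: ler_norm.
      rewrite normrM (gtr0_norm e0).
      have : e * `|g| <= 2^-1 * `|g| by rewrite ler_wpM2r.
      have := normr_ge0 g; lra.
    have h3 := ler_wpM2l (ltW e0) h1; have h4 := ler_wpM2l (ltW e0) h2.
    rewrite /K in et; rewrite /t in et; lra.
  move=> [[p q] /= [pk qk] [yr yc]]; exists (y (p, q) v) => //; split.
    by rewrite span_cat memv_add //; apply/krylov_spanP; [exists p | exists q].
  by rewrite enorm_le ?(ltW r0) // ltW.
have cy pq i : continuous (fun v => y pq v i 0) by exact: continuous_affine_coord.
apply: bigcup_open => pq _; apply: openI.
  have /continuousP : continuous (fun v => dot (y pq v) (y pq v)) by exact: continuous_dot.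
  by move=> /(_ _ (@open_lt _ (r ^+ 2))).
have /continuousP : continuous (fun v => quad A b (y pq v)).
  under eq_fun do rewrite quadE; apply: continuous_add.
    apply: continuous_mul; first exact: continuous_cst.
    apply: continuous_dot => // i.
    have eA v : A *m y pq v = A *m horner_mx A pq.1 *m b + (A *m horner_mx A pq.2) *m v.
      by rewrite mulmxDr !mulmxA.
    under eq_fun do rewrite eA.
    exact: (@continuous_affine_coord R n (A *m horner_mx A pq.2) (A *m horner_mx A pq.1 *m b) i).
  by apply: continuous_dot => // i; exact: continuous_cst.
by move=> /(_ _ (@open_lt _ c)).
Qed.

(** * Anticoncentration *)

(* The clipped linear function [max (-1) (min 1 (a / e))]. *)
Definition clip (R : realType) (e a : R) : R := (`|a + e| - `|a - e|) / (2 * e).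

Lemma bcont_clip (R : realType) n (e : R) (f : 'cV[R]_n.+1 -> R) :
  bcont f -> bcont (fun x => clip e (f x)).
Proof.
move=> bf; rewrite /clip; apply: bcontM; last exact: bcont_cst.
by apply: bcontD; [|apply: bcontN]; apply: bcont_norm; apply: bcontD => //; exact: bcont_cst.
Qed.

Lemma clip_le1 (R : realType) (e a : R) : 0 < e -> `|clip e a| <= 1.
Proof.
move=> e0; have e2 : 0 < 2 * e by rewrite mulr_gt0.
rewrite /clip normrM normfV (gtr0_norm e2) ler_pdivrMr // mul1r.
apply: le_trans (ler_dist_dist _ _) _.
by rewrite (_ : a + e - (a - e) = 2 * e) ?(gtr0_norm e2) //; ring.
Qed.

Lemma clip_id (R : realType) (e a : R) : 0 < e -> `|a| <= e -> clip e a = a / e.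
Proof.
move=> e0; rewrite ler_norml => /andP[ae ea].
rewrite /clip ger0_norm; last by lra.
rewrite ler0_norm; last by lra.
by field; exact: lt0r_neq0.
Qed.

Lemma clip_le (R : realType) (e a b : R) : 0 < e -> a <= b -> clip e a <= clip e b.
Proof.
move=> e0 ab; rewrite /clip ler_pM2r ?invr_gt0 ?mulr_gt0 //.
case: (ger0P (a + e)); case: (ger0P (a - e)); case: (ger0P (b + e)); case: (ger0P (b - e)); lra.
Qed.

(* Rotation by the angle with cosine [c] and sine [s] in the plane of the orthonormal pair [p, q]. *)
Definition rot (R : realType) n (p q : 'cV[R]_n) (c s : R) : 'M[R]_n :=
  1%:M + (c - 1) *: (p *m p^T + q *m q^T) + s *: (q *m p^T - p *m q^T).

Lemma mul_outer (R : realType) n (p q x : 'cV[R]_n) : p *m q^T *m x = dot q x *: p.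
Proof. by rewrite -mulmxA [q^T *m x]mx11_scalar mul_mx_scalar. Qed.

Lemma rotE (R : realType) n (p q : 'cV[R]_n) c s x :
  rot p q c s *m x = x + ((c - 1) * dot p x - s * dot q x) *: p
                       + ((c - 1) * dot q x + s * dot p x) *: q.
Proof.
rewrite /rot !(mulmxDl, mulmxBl) mul1mx -!scalemxAl !(mulmxDl, mulNmx) !mul_outer.
rewrite !scalerDr !scalerN !scalerA !scalerDl scaleNr -!addrA; congr (_ + (_ + _)).
by rewrite [RHS]addrC -!addrA; congr (_ + _).
Qed.

Lemma dot_delta (R : realType) n (i : 'I_n) (x : 'cV[R]_n) : dot (delta_mx i 0) x = x i 0.
Proof. by rewrite /dot trmx_delta -rowE mxE. Qed.

Lemma orthogonal_dot (R : realType) n (Q : 'M[R]_n) :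
  (forall x y, dot (Q *m x) (Q *m y) = dot x y) -> Q^T *m Q = 1%:M.
Proof.
move=> QQ; apply/matrixP => i j; have := QQ (delta_mx i 0) (delta_mx j 0).
rewrite dot_mxl !dot_delta mulmxA -colE [col _ _ _ _]mxE [delta_mx _ _ _ _]mxE andbT => ->.
by rewrite mxE.
Qed.

Lemma rot_orthogonal (R : realType) n (p q : 'cV[R]_n) c s :
  dot p p = 1 -> dot q q = 1 -> dot p q = 0 -> c ^+ 2 + s ^+ 2 = 1 ->
  (rot p q c s)^T *m rot p q c s = 1%:M.
Proof.
move=> pp qq pq cs; apply: orthogonal_dot => x y.
rewrite !rotE !dotL pp qq pq (dotC q p) pq (dotC x p) (dotC x q).
move: (dot p x) (dot q x) (dot p y) (dot q y) (dot x y) => a1 a2 a3 a4 a5.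
transitivity (a5 + (c ^+ 2 + s ^+ 2 - 1) * (a1 * a3 + a2 * a4)); first by ring.
by rewrite cs subrr mul0r addr0.
Qed.

(** Quarter turns exchange the squared coordinates, which sum to 1 on the sphere. *)
Lemma avg_coord_sqr (R : realType) n (mu : probability (borel_cV R n.+1) R) i :
  uniform_on_sphere mu -> avg mu (fun x => x i 0 ^+ 2) = n.+1%:R^-1.
Proof.
move=> unif.
have b2 j : bcont (fun x : 'cV[R]_n.+1 => x j 0 ^+ 2).
  by under eq_fun do rewrite expr2; apply: bcontM; exact: bcont_coord.
have same j : avg mu (fun x => x j 0 ^+ 2) = avg mu (fun x => x i 0 ^+ 2).
  have [->//|ji] := eqVneq j i.
  have := @avg_orthogonal _ _ mu (rot (delta_mx i 0) (delta_mx j 0) 0 1) (fun x => x i 0 ^+ 2) unif.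
  rewrite rot_orthogonal; last 4 first.
  - by rewrite dot_delta mxE !eqxx.
  - by rewrite dot_delta mxE !eqxx.
  - by rewrite dot_delta mxE eq_sym (negbTE ji).
  - by rewrite expr0n expr1n add0r.
  move=> /(_ erefl (b2 i)) <-; congr avg; apply/funext => x.
  rewrite rotE !dot_delta !mxE !eqxx eq_sym (negbTE ji) /=; ring.
have : avg mu (fun x => \sum_j x j 0 ^+ 2) = 1.
  rewrite -[RHS](avg_cst 1 unif.1) /avg; apply: eq_Rintegral => x.
  rewrite inE => /sphereE; rewrite dotE => <-.
  by apply: eq_bigr => j _; rewrite expr2.
rewrite avg_sum // (eq_bigr _ (fun j _ => same j)) sumr_const card_ord => h.
apply: (@mulfI _ n.+1%:R); first by rewrite pnatr_eq0.
by rewrite mulfV ?pnatr_eq0 // mulr_natl.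
Qed.

(** A finite-difference form of [E[x_j^2 h'(x_i)] = E[x_i h(x_i)]] for [h = clip e], which avoids
    differentiating [h]: the average of [h(x_i) x_j] is the same after rotation by either of two
    opposite angles, and the two expressions are subtracted. *)
Lemma avg_rotation_defect (R : realType) n (mu : probability (borel_cV R n.+1) R) (i j : 'I_n.+1) (e c s : R) :
  uniform_on_sphere mu -> i != j -> c ^+ 2 + s ^+ 2 = 1 ->
  avg mu (fun x => s * x i 0 * (clip e (c * x i 0 + s * x j 0) + clip e (c * x i 0 - s * x j 0))
    - c * x j 0 * (clip e (c * x i 0 + s * x j 0) - clip e (c * x i 0 - s * x j 0))) = 0.
Proof.
move=> unif ij cs.
pose G (x : 'cV[R]_n.+1) := clip e (x i 0) * x j 0.
have bG : bcont G by apply: bcontM; [apply: bcont_clip|]; exact: bcont_coord.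
have rotG s' : c ^+ 2 + s' ^+ 2 = 1 ->
    avg mu (fun x => clip e (c * x i 0 - s' * x j 0) * (c * x j 0 + s' * x i 0)) = avg mu G.
  move=> cs'; rewrite -(@avg_orthogonal _ _ mu (rot (delta_mx i 0) (delta_mx j 0) c s') G unif) //; last first.
    apply: rot_orthogonal => //; rewrite dot_delta mxE ?eqxx //.
    by rewrite (negbTE ij).
  congr avg; apply/funext => x.
  rewrite /G rotE !dot_delta !mxE !eqxx (negbTE ij) eq_sym (negbTE ij) /=.
  by congr (clip e _ * _); ring.
have h1 := rotG s cs.
have h2 : avg mu (fun x => clip e (c * x i 0 + s * x j 0) * (c * x j 0 - s * x i 0)) = avg mu G.
  rewrite -(rotG (- s)) ?sqrrN //; congr avg; apply/funext => x.
  by congr (clip e _ * _); ring.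
have bl a b : bcont (fun x : 'cV[R]_n.+1 => a * x i 0 + b * x j 0).
  by apply: bcontD; apply: bcontZ; exact: bcont_coord.
have b1 : bcont (fun x : 'cV[R]_n.+1 => clip e (c * x i 0 - s * x j 0) * (c * x j 0 + s * x i 0)).
  apply: bcontM; first by apply: bcont_clip; have := bl c (- s); under eq_fun do rewrite mulNr.
  by have := bl s c; under eq_fun do rewrite addrC.
have b2 : bcont (fun x : 'cV[R]_n.+1 => clip e (c * x i 0 + s * x j 0) * (c * x j 0 - s * x i 0)).
  apply: bcontM; first exact: bcont_clip.
  by have := bl (- s) c; under eq_fun do rewrite addrC mulNr.
transitivity (avg mu (fun x => clip e (c * x i 0 - s * x j 0) * (c * x j 0 + s * x i 0)
   + (-1) * (clip e (c * x i 0 + s * x j 0) * (c * x j 0 - s * x i 0)))).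
  by congr avg; apply/funext => x; ring.
rewrite avgD //; last exact: bcontZ.
by rewrite avgZ // h1 h2 mulN1r subrr.
Qed.

(** Markov's inequality: the sphere is split along [B], and the part outside [B] contributes at
    least 0. *)
Lemma avg_markov (R : realType) n (mu : probability (borel_cV R n.+1) R) F k
    (B : set (borel_cV R n.+1)) :
  bcont F -> measurable B -> (forall x, sphere x -> 0 <= F x) ->
  (forall x, sphere x -> B x -> k <= F x) ->
  k * fine (mu (@sphere R n `&` B)) <= avg mu F.
Proof.
move=> bF mB F0 Fk; have mS := @measurable_sphere R n.
have mSB : measurable (@sphere R n `&` B) by exact: measurableI.
have mSD : measurable (@sphere R n `\` B) by exact: measurableD.
have iF := bcont_integrable mu bF.
have iFk : mu.-integrable (@sphere R n `&` B) (EFin \o F).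
  by apply: integrableS iF => //; exact: subIsetl.
rewrite /avg -{2}(setUIDK (@sphere R n) B) Rintegral_setU //; last 2 first.
- by rewrite setUIDK.
- by rewrite disj_set2E; apply/eqP; rewrite setIDA setDE -setIA; apply/seteqP; split => x //= [[_ Bx] [_ nB]].
rewrite -[leLHS]addr0; apply: lerD.
  rewrite -Rintegral_cst //; apply: le_Rintegral => //.
    apply: integrableS (bcont_integrable mu (bcont_cst n k)) => //; exact: subIsetl.
  by move=> x [Sx Bx]; exact: Fk.
by apply: Rintegral_ge0 => x [Sx _]; exact: F0.
Qed.

Lemma measurable_slab (R : realType) n (u : 'cV[R]_n.+1) (e : R) :
  measurable ([set x : 'cV[R]_n.+1 | `|dot u x| < e] : set (borel_cV R n.+1)).
Proof.
apply: sub_sigma_algebra.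
have : continuous (fun x : 'cV[R]_n.+1 => `|dot u x|).
  apply: continuous_abs; apply: continuous_dot => i; last exact: continuous_coord.
  exact: continuous_cst.
by move=> /continuousP/(_ _ (@open_lt _ e)).
Qed.

(** The sign follows from monotonicity of [clip]. If [|a| + s <= e], both arguments stay in the
    range where [clip] is linear of slope [1 / e]. *)
Lemma clip_slope (R : realType) (e c s a b : R) : 0 < e -> 0 <= s -> 0 < c <= 1 -> `|b| <= 1 ->
  [/\ 0 <= b * (clip e (c * a + s * b) - clip e (c * a - s * b)) &
   `|a| + s <= e ->
    2 * s / e * b ^+ 2 <= b * (clip e (c * a + s * b) - clip e (c * a - s * b))].
Proof.
move=> e0 s0 /andP[c0 c1] b1; split.
  have [b0|b0] := leP 0 b.
    rewrite mulr_ge0 // subr_ge0 clip_le //.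
    by have := mulr_ge0 s0 b0; lra.
  rewrite mulr_le0 ?(ltW b0) // subr_le0 clip_le //.
  by have := mulr_ge0_le0 s0 (ltW b0); lra.
move=> ae.
have ca : `|c * a| <= `|a| by rewrite normrM (gtr0_norm c0) -[leRHS]mul1r ler_wpM2r.
have sb : `|s * b| <= s by rewrite normrM (ger0_norm s0) -[leRHS]mulr1 ler_wpM2l.
rewrite !clip_id //; last 2 first.
- by apply: le_trans (ler_normB _ _) _; lra.
- by apply: le_trans (ler_normD _ _) _; lra.
by rewrite le_eqVlt; apply/orP; left; apply/eqP; field; exact: lt0r_neq0.
Qed.

(* The averages of [clip (x_i) x_j] over the rotations by the angles of sines
   [s] and [-s] agree.  Summing over [j], this bounds the mass of the slab of
   half-width [e] by [E|x_i|], up to an error that vanishes with [s]. *)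
Lemma sphere_slab_coord (R : realType) n (mu : probability (borel_cV R n.+1) R) (i : 'I_n.+1) (e : R) :
  uniform_on_sphere mu -> 0 < e -> e ^+ 2 * n.+1%:R <= 1 ->
  fine (mu (@sphere R n `&` [set x : 'cV[R]_n.+1 | `|dot (delta_mx i 0) x| < e])) <=
   e * Num.sqrt n.+1%:R.
Proof.
move=> unif e0 ed; set B := [set x : 'cV[R]_n.+1 | _].
have mB : measurable (B : set (borel_cV R n.+1)) by exact: measurable_slab.
set D : R := Num.sqrt n.+1%:R.
have D2 : D ^+ 2 = n.+1%:R by rewrite sqr_sqrtr ?ler0n.
have D0 : 0 < D by rewrite sqrtr_gt0 ltr0n.
set m := fine _.
have m1 : m <= 1.
  have mSB : measurable (@sphere R n `&` B) by apply: measurableI => //; exact: measurable_sphere.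
  by rewrite -lee_fin /m fineK ?fin_num_measure //; exact: probability_le1.
apply/ler_addgt0Pr => eta eta0.
(* The final error will be [s (D + 1)]: [s D] from widening the slab and [s] from the cosine
   [c >= 1 - s]. *)
pose s : R := Num.min (2^-1) (eta / (D + 1)).
have D1 : 0 < D + 1 by lra.
have s0 : 0 < s by rewrite lt_min invr_gt0 ltr0n divr_gt0.
have s1 : s <= 2^-1 by rewrite ge_min lexx.
have se : s * (D + 1) <= eta by rewrite -ler_pdivlMr // ge_min lexx orbT.
pose c : R := Num.sqrt (1 - s ^+ 2).
have s2 : s ^+ 2 <= s by rewrite expr2 -[leRHS]mulr1 ler_wpM2l ?(ltW s0) //; lra.
have c2 : c ^+ 2 = 1 - s ^+ 2 by rewrite sqr_sqrtr //; lra.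
have cs : c ^+ 2 + s ^+ 2 = 1 by rewrite c2 subrK.
have c0 : 0 < c by rewrite sqrtr_gt0; lra.
have c1 : c <= 1.
  by rewrite -[leRHS]sqrtr1 ler_wsqrtr // gerBl sqr_ge0.
have c1s : 1 - s <= c.
  rewrite -ler_sqr ?nnegrE ?(ltW c0) ?c2 //; last by lra.
  by rewrite sqrrB expr1n; lra.
(* Widened so that the rotated arguments remain in the linear range when [|x_i| < e]. *)
pose e' := e + s.
have e'0 : 0 < e' by rewrite addr_gt0.
pose Df (j : 'I_n) (x : 'cV[R]_n.+1) : R :=
  s * x i 0 * (clip e' (c * x i 0 + s * x (lift i j) 0) + clip e' (c * x i 0 - s * x (lift i j) 0))
  - c * x (lift i j) 0 * (clip e' (c * x i 0 + s * x (lift i j) 0) - clip e' (c * x i 0 - s * x (lift i j) 0)).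
have bl a b j : bcont (fun x : 'cV[R]_n.+1 => a * x i 0 + b * x (lift i j) 0).
  by apply: bcontD; apply: bcontZ; exact: bcont_coord.
have bl' a b j : bcont (fun x : 'cV[R]_n.+1 => a * x i 0 - b * x (lift i j) 0).
  by have := bl a (- b) j; under eq_fun do rewrite mulNr.
have bD j : bcont (Df j).
  have b1 := bcont_clip e' (bl c s j); have b2 := bcont_clip e' (bl' c s j).
  apply: bcontD.
    by apply: bcontM; [apply: bcontZ; exact: bcont_coord | exact: bcontD].
  apply: bcontN; apply: bcontM; first by apply: bcontZ; exact: bcont_coord.
  by apply: bcontD => //; exact: bcontN.
pose N : R := n%:R.
(* [2 |x_i| <= D x_i^2 + 1 / D] replaces the first absolute moment by the second moment, known to be
   [1 / D^2]; the defects [Df] average to 0. *)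
pose F (x : 'cV[R]_n.+1) : R := s * N * D * (x i 0 * x i 0) + (s * N / D + (-1) * \sum_j Df j x).
have bx2 : bcont (fun x : 'cV[R]_n.+1 => x i 0 * x i 0) by apply: bcontM; exact: bcont_coord.
have bS : bcont (fun x : 'cV[R]_n.+1 => \sum_j Df j x) by exact: bcont_sum.
have bF : bcont F.
  apply: bcontD; first exact: bcontZ.
  by apply: bcontD; [exact: bcont_cst | exact: bcontZ].
have avgF : avg mu F = 2 * s * N / D.
  rewrite /F avgD; [|exact: bcontZ|by apply: bcontD; [exact: bcont_cst|exact: bcontZ]].
  rewrite avgZ // avgD; [|exact: bcont_cst|exact: bcontZ].
  rewrite (avgZ mu (-1) bS) avg_sum // big1; last first.
    by move=> j _; apply: avg_rotation_defect => //; exact: neq_lift.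
  rewrite avg_cst; last exact: unif.1.
  have := avg_coord_sqr i unif; under eq_fun do rewrite expr2; move=> ->.
  by rewrite -D2; field; exact: lt0r_neq0.
have FE x : sphere x ->
    \sum_(j < n) c * (x (lift i j) 0 * (clip e' (c * x i 0 + s * x (lift i j) 0) - clip e' (c * x i 0 - s * x (lift i j) 0))) <= F x.
  move=> Sx; rewrite /F.
  have h1 : 2 * `|x i 0| <= D * (x i 0 * x i 0) + D^-1.
    have h0 := mulr_ge0 (ltW D0) (sqr_ge0 (`|x i 0| - D^-1)).
    have e1 : D * (`|x i 0| - D^-1) ^+ 2 = D * `|x i 0| ^+ 2 + D^-1 - 2 * `|x i 0|.
      by field; exact: lt0r_neq0.
    rewrite e1 real_normK ?num_real // expr2 in h0; lra.
  have h2 : \sum_j Df j x + \sum_(j < n) c * (x (lift i j) 0 * (clip e' (c * x i 0 + s * x (lift i j) 0) - clip e' (c * x i 0 - s * x (lift i j) 0))) <= N * (2 * (s * `|x i 0|)).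
    have -> : N * (2 * (s * `|x i 0|)) = \sum_(j < n) 2 * (s * `|x i 0|).
      by rewrite sumr_const card_ord -[RHS]mulr_natl.
    rewrite -big_split; apply: ler_sum => j _ /=.
    have := clip_le1 (c * x i 0 - s * x (lift i j) 0) e'0.
    have := clip_le1 (c * x i 0 + s * x (lift i j) 0) e'0.
    rewrite /Df; set p := clip _ _; set q := clip _ _ => p1 q1.
    have -> : s * x i 0 * (p + q) - c * x (lift i j) 0 * (p - q) + c * (x (lift i j) 0 * (p - q)) =
      s * x i 0 * (p + q) by ring.
    apply: le_trans (ler_norm _) _; rewrite 2!normrM (gtr0_norm s0) mulrC ler_wpM2r ?mulr_ge0 ?(ltW s0) //.
    by apply: le_trans (ler_normD _ _) _; rewrite -[2]/(1 + 1) lerD.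
  have h3 : s * N * (2 * `|x i 0|) <= s * N * (D * (x i 0 * x i 0) + D^-1).
    by rewrite ler_wpM2l // mulr_ge0 ?ler0n ?(ltW s0).
  lra.
have F0 x : sphere x -> 0 <= F x.
  move=> Sx; apply: le_trans (FE x Sx); apply: sumr_ge0 => j _; rewrite mulr_ge0 ?(ltW c0) //.
  by have [] := @clip_slope R e' c s (x i 0) (x (lift i j) 0) e'0 (ltW s0) _ (sphere_coord _ Sx); rewrite ?c0.
have FB x : sphere x -> B x -> c * (2 * s / e') * (1 - e ^+ 2) <= F x.
  move=> Sx; rewrite /B /= dot_delta => xe; apply: le_trans (FE x Sx).
  have sx : \sum_(j < n) x (lift i j) 0 ^+ 2 = 1 - x i 0 ^+ 2.
    have /sphereE := Sx; rewrite dotE (bigD1_ord i) //= => <-.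
    by rewrite expr2 addrC addrK; apply: eq_bigr => j _; rewrite expr2.
  have h : 1 - e ^+ 2 <= \sum_(j < n) x (lift i j) 0 ^+ 2.
    rewrite sx lerD2l lerN2 -(real_normK (num_real (x i 0))) ler_sqr ?nnegrE ?(ltW e0) ?(ltW xe) //.
  apply: le_trans (ler_wpM2l _ h) _.
    by rewrite mulr_ge0 ?(ltW c0) // divr_ge0 ?mulr_ge0 ?(ltW s0) ?(ltW e'0).
  rewrite mulr_sumr; apply: ler_sum => j _; rewrite -[leLHS]mulrA ler_wpM2l ?(ltW c0) //.
  have [|_ ->] // := @clip_slope R e' c s (x i 0) (x (lift i j) 0) e'0 (ltW s0) _ (sphere_coord _ Sx).
    by rewrite c0.
  by rewrite /e' lerD2r ltW.
have := avg_markov mu bF mB F0 FB; rewrite -/m avgF => main.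
(* In dimension one the sphere is two points and [e <= 1], so the slab misses it; otherwise division
   by [N] is possible. *)
have [n0|n0] := posnP n.
  rewrite /m (_ : _ `&` _ = set0) ?measure0 /=.
    by rewrite addr_ge0 ?mulr_ge0 ?(ltW e0) ?(ltW D0) ?(ltW eta0).
  apply/seteqP; split => x //= [/sphereE Sx]; rewrite /B /= dot_delta => xe.
  move: Sx; rewrite dotE (bigD1_ord i) //= big1 ?addr0 => [xx|j _]; last first.
    by have := ltn_ord j; rewrite [X in (_ < X)%N]n0.
  have : `|x i 0| ^+ 2 < e ^+ 2 by rewrite ltr_sqr ?nnegrE ?(ltW e0).
  by rewrite real_normK ?num_real // expr2 xx; move: ed; rewrite n0 mulr1 => /le_lt_trans h /h; rewrite ltxx.
have N0 : 0 < N by rewrite ltr0n.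
have m0 : 0 <= m by rewrite fine_ge0.
have DN : D ^+ 2 = N + 1 by rewrite D2 -natr1.
(* The smallness of [e] gives [1 - e^2 >= (d - 1) / d], so that the factor [N] cancels on both
   sides. *)
have eN : N / D ^+ 2 <= 1 - e ^+ 2.
  have : e ^+ 2 <= 1 / D ^+ 2 by rewrite ler_pdivlMr ?exprn_gt0 // D2.
  have -> : N = D ^+ 2 - 1 by rewrite DN addrK.
  rewrite mulrBl divff ?mul1r; first by lra.
  by rewrite expf_neq0 // gt_eqF.
have : c * (2 * s / e') * (N / D ^+ 2) * m <= 2 * s * N / D.
  apply: le_trans main; rewrite ler_wpM2r // ler_wpM2l //.
  by rewrite mulr_ge0 ?(ltW c0) // divr_ge0 ?mulr_ge0 ?(ltW s0) ?(ltW e'0).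
have -> : c * (2 * s / e') * (N / D ^+ 2) * m = (2 * s * N / D) * (c * m / (e' * D)).
  by field; rewrite !gt_eqF.
have K0 : 0 < 2 * s * N / D by rewrite divr_gt0 ?mulr_gt0.
rewrite -[leRHS]mulr1 ler_pM2l // ler_pdivrMr ?mulr_gt0 // mul1r => cm.
have : (1 - s) * m <= c * m by rewrite ler_wpM2r.
have : s * m <= s * 1 by rewrite ler_wpM2l // ltW.
rewrite /e' in cm; lra.
Qed.

(** The Householder reflection in the hyperplane orthogonal to [u - delta_mx i 0], or the identity
    if that vector vanishes. *)
Lemma reflection (R : realType) n (u : 'cV[R]_n) (i : 'I_n) : dot u u = 1 ->
  exists2 Q : 'M[R]_n, Q^T *m Q = 1%:M & Q *m delta_mx i 0 = u.
Proof.
move=> uu; pose w := u - delta_mx i 0.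
have [w0|w0] := eqVneq w 0.
  exists 1%:M; first by rewrite trmx1 mulmx1.
  by rewrite mul1mx; apply/esym/eqP; rewrite -subr_eq0 -/w w0.
have ww0 : dot w w != 0 by rewrite dot_eq0.
have wi : dot w (delta_mx i 0) = - (dot w w / 2).
  by rewrite /w !dotL uu dot_delta (dotC u) !dot_delta mxE !eqxx /=; field.
have wu : delta_mx i 0 + w = u by rewrite /w addrC subrK.
clearbody w; pose k := 2 / dot w w.
exists (1%:M - k *: (w *m w^T)) => [|].
  apply: orthogonal_dot => x y.
  rewrite !mulmxBl !mul1mx -!scalemxAl !mul_outer !dotL (dotC x w) /k.
  by field.
rewrite mulmxBl mul1mx -scalemxAl mul_outer scalerA.
rewrite wi (_ : k * - (dot w w / 2) = -1); last by rewrite /k; field.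
by rewrite scaleN1r opprK.
Qed.

Lemma sphere_slab (R : realType) n (mu : probability (borel_cV R n.+1) R) (u : 'cV[R]_n.+1) (e : R) :
  uniform_on_sphere mu -> dot u u = 1 -> 0 < e -> e ^+ 2 * n.+1%:R <= 1 ->
  fine (mu (@sphere R n `&` [set x : 'cV[R]_n.+1 | `|dot u x| < e])) <= e * Num.sqrt n.+1%:R.
Proof.
move=> unif uu e0 ed; have [Q QQ Qu] := reflection ord0 uu.
apply: le_trans (sphere_slab_coord ord0 unif e0 ed); rewrite le_eqVlt; apply/orP; left; apply/eqP.
congr fine; rewrite -[LHS](unif.2 Q QQ); last first.
  by apply: measurableI; [exact: measurable_sphere | exact: measurable_slab].
have dQ x y : dot (Q *m x) (Q *m y) = dot x y by rewrite dot_mxl mulmxA QQ mul1mx.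
congr (mu _); apply/seteqP; split => x [/sphereE Sx xe]; split.
- by apply/sphereE; rewrite -dQ.
- by rewrite /= -(dQ _ x) Qu.
- by apply/sphereE; rewrite dQ.
- by rewrite /= -Qu dQ.
Qed.

(** * Measurability and probability of the success event *)

Theorem corollary2 (R : realType) (d : nat) (A : 'M[R]_d) (b : 'cV[R]_d)
    (r lmin lmax : R) (xstar : 'cV[R]_d)
    (disp : measure_display) (Omega : measurableType disp)
    (P : probability Omega R) (v : {RV P >-> borel_cV R d})
    (t : nat) (s : Omega -> 'cV[R]_d) (delta : R) :
  A^T = A ->
  0 < r ->
  smallest_eigenvalue A lmin ->
  largest_eigenvalue A lmax ->
  is_argmin (quad A b) [set x | enorm x <= r] xstar ->
  uniform_on_sphere (distribution P v) ->
  (2 <= t)%N ->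
  (forall w : Omega,
     is_argmin (quad A b)
       [set x | x \in <<krylov A b (t %/ 2) ++ krylov A (v w) (t %/ 2)>>%VS /\
                enorm x <= r]
       (s w)) ->
  0 < delta ->
  let E := [set w : Omega |
    quad A b (s w) - quad A b xstar <=
      (lmax - lmin) * r ^+ 2 / (t%:R - 1) ^+ 2 *
      (16 + 2 * (lmin < 0)%R%:R * ln (2 * Num.sqrt d%:R / delta) ^+ 2)] in
  measurable E /\ ((1 - delta)%:E <= P E)%E.
Proof.
case: d A b xstar v s => [|n] A b xs v s sA r0 mineig maxeig [xsr _] unif t2 sopt delta0 /=.
  (* In dimension 0 there is no nonzero vector, hence no eigenvalue. *)
  by case: mineig => /eigenvalueP[w _]; rewrite thinmx0 eqxx.
set C := _ * (16 + _); set E := [set w | _].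
have mE : measurable E.
  (* By minimality of [s w], the event says that for every [j] some feasible point has value below
     the target plus [1 / (j + 1)]: a countable intersection of preimages of open sets. *)
  pose V j := [set x : 'cV[R]_n.+1 | exists2 y, quad A b y < C + quad A b xs + j.+1%:R^-1 &
    y \in <<krylov A b (t %/ 2) ++ krylov A x (t %/ 2)>>%VS /\ enorm y <= r].
  have -> : E = \bigcap_j (v @^-1` V j).
    apply/seteqP; split => w /=.
      rewrite /E /= => Ew j _; exists (s w); last by case: (sopt w).
      by apply: (@le_lt_trans _ _ (C + quad A b xs)); rewrite -?lerBlDr // ltrDl invr_gt0 ltr0n.
    move=> Vw; rewrite /E /= lerBlDr; apply/ler_addgt0Pr => eta eta0.
    have [j] := ltr_add_invr eta0; rewrite add0r => jeta.
    have [y yc yK] := Vw j I; case: (sopt w) => _ /(_ y yK) sy.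
    by apply: le_trans sy _; apply: ltW; apply: lt_trans yc _; rewrite ltrD2l.
  apply: bigcapT_measurable => j; rewrite -[X in measurable X]setTI.
  apply: (measurable_funP v) => //; apply: sub_sigma_algebra.
  exact: open_krylov_sublevel.
split=> //.
have [u uu Au] : exists2 u : 'cV[R]_n.+1, dot u u = 1 & A *m u = lmin *: u.
  case: mineig => /eigenvalueP[w wA w0] _.
  have ww : 0 < dot w^T w^T.
    by rewrite lt_def dot_ge0 dot_eq0 andbT -trmx0 (inj_eq trmx_inj).
  exists ((Num.sqrt (dot w^T w^T))^-1 *: w^T).
    by rewrite dotZl dotZr mulrA -expr2 exprVn sqr_sqrtr ?mulVf ?gt_eqF // ltW.
  by rewrite -scalemxAr -[A in A *m _]sA -trmx_mul wA linearZ /= !scalerA mulrC.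
have {}xsr : dot xs xs <= r ^+ 2 by rewrite -enorm_le // ltW.
have [delta1|delta1] := leP 1 delta.
  by apply: le_trans (measure_ge0 _ _); rewrite lee_fin subr_le0.
have [lm|lm] := ltP lmin 0; last first.
  (* The bound holds surely here: the logarithm has factor 0, and [rho = 1] is a dummy value. *)
  have -> : E = setT.
    apply/seteqP; split => // w _; rewrite /E /= /C.
    have := krylov_gap (rho := 1) (v := v w) sA r0 mineig maxeig xsr t2 (sopt w) Au uu.
    by rewrite (ltNge lmin) lm /= !mulr0 !mul0r; apply; rewrite ?ltr01 ?lexx.
  by rewrite probability_setT lee_fin gerBl ltW.
pose mu : probability (borel_cV R n.+1) R := distribution P v.
pose D : R := Num.sqrt n.+1%:R.
have D2 : D ^+ 2 = n.+1%:R by rewrite sqr_sqrtr ?ler0n.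
have D0 : 0 < D by rewrite sqrtr_gt0 ltr0n.
have D1 : 1 <= D by rewrite -[leLHS]sqrtr1 ler_wsqrtr // ler1n.
(* Then [2 / rho] is the argument of the logarithm, and the slab of half-width [rho] has mass at
   most [rho D = delta]. *)
pose rho := delta / D.
have rho0 : 0 < rho by rewrite divr_gt0.
have rho1 : rho <= 1 by rewrite ler_pdivrMr // mul1r (le_trans (ltW delta1)).
have rhoD : rho ^+ 2 * n.+1%:R <= 1.
  by rewrite -D2 -exprMn /rho divfK ?gt_eqF // expr_le1 // ltW.
have mS := @measurable_sphere R n.
have mB := measurable_slab u rho; set B := [set x | _] in mB.
have sub : v @^-1` (@sphere R n `\` B) `<=` E.
  move=> w [/sphereE Sw /negP]; rewrite -leNgt => rw; rewrite /E /= /C.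
  have := krylov_gap (rho := rho) (v := v w) sA r0 mineig maxeig xsr t2 (sopt w) Au uu.
  have -> : 2 / rho = 2 * D / delta by rewrite /rho; field; rewrite !gt_eqF.
  by apply=> //; rewrite rho0 rho1.
have mSB : measurable (@sphere R n `\` B) by exact: measurableD.
have leE : (P (v @^-1` (@sphere R n `\` B)) <= P E)%E.
  apply: le_measure; rewrite ?inE //.
  by rewrite -[X in measurable X]setTI; exact: (measurable_funP v).
apply: le_trans (leE : (mu (@sphere R n `\` B) <= P E)%E).
have fin X : measurable X -> mu X = (fine (mu X))%:E.
  by move=> mX; rewrite fineK // fin_num_measure.
have slab := sphere_slab unif uu rho0 rhoD.
rewrite measureD //; last by apply: le_lt_trans (probability_le1 mu mS) (ltry _).
have slabE : (mu (@sphere R n `&` B) <= (rho * D)%:E)%E.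
  by rewrite (fin _ (measurableI _ _ mS mB)) lee_fin; exact: slab.
have S1 : (1 <= mu (@sphere R n))%E by rewrite (_ : mu _ = 1%E) //; exact: unif.1.
apply: (@le_trans _ _ (1 - (rho * D)%:E)%E).
  by rewrite /rho divfK ?gt_eqF // -EFinB.
by apply: leeB; [exact: S1 | exact: slabE].
Qed.
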